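(* Let $q\ge 1$ and $[q]=\{1,\dots,q\}$. There exists a randomised algorithm which, given two product distributions $P=P_1\otimes\cdots\otimes P_n$ and $Q=Q_1\otimes\cdots\otimes Q_n$ over $[q]^n$ (each specified by the list of marginal probabilities $P_i(c),Q_i(c)$ for $i\in[n]$, $c\in[q]$) and parameters $\epsilon>0$ and $0<\delta<1$, runs in time $O\!\left(\frac{n^3}{\epsilon^2}\log\frac{1}{\delta}\right)$ and outputs a random value $\widehat d$ such that $$\Pr\left[(1-\epsilon)\,d_{TV}(P,Q)\le \widehat d\le (1+\epsilon)\,d_{TV}(P,Q)\right]\ge 1-\delta.$$
   Context: For distributions $P,Q$ on a finite set $\Omega$, the total variation distance is $d_{TV}(P,Q)=\frac12\sum_{\omega\in\Omega}|P(\omega)-Q(\omega)|$. The running time is measured assuming every arithmetic operation on real numbers (and sampling from an explicitly given distribution on $[q]$) costs $O(1)$ time; the dependence on $q$ is treated as a constant (hidden factor linear in $q$).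
   Formalization: The running time is stated as O((1+n³/ε²)(1+log(1/δ))), with a constant depending on q, since the literal bound falls below a single step when δ tends to 1, ε is large or n=0; for n≥1, ε≤1 and δ≤1/2 the two bounds agree up to a constant factor. *)

(* Defs.v *)
(* concrete classical reals R.
   Model of computation: a real-RAM (BSS-style machine) with integer registers,
   real registers (indirectly addressed via integer registers), unit-cost
   real arithmetic (+,-,*,/), comparisons, and unit-cost sampling from an
   explicitly given distribution on [q] = {0,...,q-1}. *)
From Stdlib Require Import Reals List Arith.
Import ListNotations.
Open Scope R_scope.

Definition rsum {A : Type} (l : list A) (f : A -> R) : R :=
  fold_right (fun a acc => f a + acc) 0 l.

Fixpoint tuples (q n : nat) : list (list nat) :=
  match n with
  | O => [[]]
  | S m => flat_map (fun c => map (cons c) (tuples q m)) (seq 0 q)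
  end.

Definition prod_prob (P : nat -> nat -> R) (x : list nat) : R :=
  fold_right Rmult 1 (map (fun i => P i (nth i x O)) (seq 0 (length x))).

Definition dTV (q n : nat) (P Q : nat -> nat -> R) : R :=
  / 2 * rsum (tuples q n) (fun x => Rabs (prod_prob P x - prod_prob Q x)).

Definition is_marginals (q n : nat) (P : nat -> nat -> R) : Prop :=
  forall i, (i < n)%nat ->
    (forall c, (c < q)%nat -> 0 <= P i c) /\ rsum (seq 0 q) (P i) = 1.

Record state := mkState { pc : nat; ireg : nat -> nat; rreg : nat -> R }.

Definition updn (f : nat -> nat) (d v : nat) : nat -> nat :=
  fun k => if Nat.eqb k d then v else f k.
Definition updr (f : nat -> R) (d : nat) (v : R) : nat -> R :=
  fun k => if Nat.eqb k d then v else f k.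

Inductive rop := RAdd | RSub | RMul | RDiv.

Definition eval_rop (o : rop) (x y : R) : R :=
  match o with RAdd => x + y | RSub => x - y | RMul => x * y | RDiv => x / y end.

Inductive instr :=
| IConst (d k : nat)
| IAdd (d a b : nat)
| ISub (d a b : nat)                 (* ireg d := ireg a - ireg b (truncated) *)
| IJle (a b t : nat)
| RConst (d k : nat)
| RofI (d a : nat)
| RArith (o : rop) (d a b : nat)
| RJle (a b t : nat)
| Sample (d base : nat)
| Halt.

Definition exec_det (i : instr) (s : state) : state :=
  let p := pc s in let I := ireg s in let Rg := rreg s in
  match i with
  | IConst d k => mkState (S p) (updn I d k) Rg
  | IAdd d a b => mkState (S p) (updn I d (I a + I b)%nat) Rg
  | ISub d a b => mkState (S p) (updn I d (I a - I b)%nat) Rg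
  | IJle a b t => mkState (if Nat.leb (I a) (I b) then t else S p) I Rg
  | RConst d k => mkState (S p) I (updr Rg (I d) (INR k))
  | RofI d a => mkState (S p) I (updr Rg (I d) (INR (I a)))
  | RArith o d a b => mkState (S p) I (updr Rg (I d) (eval_rop o (Rg (I a)) (Rg (I b))))
  | RJle a b t => mkState (if Rle_dec (Rg (I a)) (Rg (I b)) then t else S p) I Rg
  | Sample _ _ | Halt => s
  end.

Definition valid_weights (q : nat) (w : nat -> R) : bool :=
  forallb (fun c => if Rle_dec 0 (w c) then true else false) (seq 0 q)
  && (if Req_EM_T (rsum (seq 0 q) w) 1 then true else false).

(* run q prog fuel G s = E[ G(output) ; the machine halts within fuel steps ],
   each executed instruction (including Halt) costing one step.
   Sampling from an invalid weight vector, or jumping outside the program,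
   makes the machine stuck (never halts). *)
Fixpoint run (q : nat) (prog : list instr) (fuel : nat) (G : R -> R) (s : state) : R :=
  match fuel with
  | O => 0
  | S f =>
    match nth_error prog (pc s) with
    | None => 0
    | Some Halt => G (rreg s 0)
    | Some (Sample d b) =>
        let w := fun c => rreg s (ireg s b + c)%nat in
        if valid_weights q w then
          rsum (seq 0 q) (fun c =>
            w c * run q prog f G (mkState (S (pc s)) (updn (ireg s) d c) (rreg s)))
        else 0
    | Some i => run q prog f G (exec_det i s)
    end
  end.

(* Input layout: ireg 0 = n; rreg 0 = eps, rreg 1 = delta,
   rreg (2 + i*q + c) = P_i(c), rreg (2 + n*q + i*q + c) = Q_i(c); else 0. *)
Definition init (q n : nat) (P Q : nat -> nat -> R) (eps delta : R) : state :=
  mkState 0 (fun k => if Nat.eqb k 0 then n else O)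
    (fun k =>
       if Nat.eqb k 0 then eps
       else if Nat.eqb k 1 then delta
       else if Nat.ltb k (2 + n * q) then P ((k - 2) / q)%nat ((k - 2) mod q)%nat
       else if Nat.ltb k (2 + 2 * n * q)
            then Q ((k - 2 - n * q) / q)%nat ((k - 2 - n * q) mod q)%nat
       else 0).

Definition ind_interval (a b : R) (x : R) : R :=
  if Rle_dec a x then (if Rle_dec x b then 1 else 0) else 0.

(* Main.v *)
Require Import Defs.
From Stdlib Require Import Reals List Arith.
From Stdlib Require Import ZArith Lra Lia FunctionalExtensionality.
Import ListNotations.
Open Scope R_scope.

(* Importance sampling.  With p_i = (P_i - Q_i)^+, consider the measure
   R(x) = sum_i p_i(x_i) prod_(j <> i) P_j(x_j), of total mass
   D = sum_i dTV(P_i, Q_i) <= n dTV(P, Q).  It dominates (P - Q)^+ pointwise, so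
   for x of law R / D the ratio f(x) = (P(x) - Q(x))^+ / R(x) lies in [0,1] and has
   mean dTV(P, Q) / D >= 1/n.  A variable in [0,1] of mean mu satisfies
   E exp(t f) <= exp((t + 2t^2) mu) for |t| <= 1/2, and Chernoff's argument shows
   that O(n/eps^2 log(1/delta)) samples suffice; averaging directly then avoids
   a median of means.  The law R / D is sampled coordinate by coordinate, in O(n)
   steps: given the prefix products a of P and h of R, the weight of the suffixes is
   h + a (d_i + ... + d_n), where d_j = dTV(P_j, Q_j).
   For eps >= 1 or D = 0 the answer 0 is correct; the first case is needed because
   the time bound leaves no time to read the input when eps is large. *)

(** * Positive parts and finite sums *)

Definition pos_part (x : R) : R := Rmax 0 x.

Lemma pos_ge0 x : 0 <= pos_part x.
Proof. apply Rmax_l. Qed.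

Lemma pos_ge x : x <= pos_part x.
Proof. apply Rmax_r. Qed.

Lemma pos_id x : 0 <= x -> pos_part x = x.
Proof. apply Rmax_right. Qed.

Lemma pos_0 x : x <= 0 -> pos_part x = 0.
Proof. apply Rmax_left. Qed.

Lemma pos_le x y : 0 <= y -> x <= y -> pos_part x <= y.
Proof. apply Rmax_lub. Qed.

Lemma Rabs_pos x : Rabs x = 2 * pos_part x - x.
Proof. unfold pos_part, Rmax, Rabs. destruct (Rle_dec 0 x), (Rcase_abs x); lra. Qed.

Section Rsum.
Context {A : Type}.
Implicit Types (l : list A) (f g : A -> R).

Lemma rsum_ext l f g : (forall x, In x l -> f x = g x) -> rsum l f = rsum l g.
Proof.
  induction l as [|x l IH]; simpl; intros H; [easy|].
  rewrite H, IH; auto.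
Qed.

Lemma rsum_le l f g : (forall x, In x l -> f x <= g x) -> rsum l f <= rsum l g.
Proof.
  induction l as [|x l IH]; simpl; intros H; [lra|].
  apply Rplus_le_compat; auto.
Qed.

Lemma rsum_app l1 l2 f : rsum (l1 ++ l2) f = rsum l1 f + rsum l2 f.
Proof. induction l1 as [|x l IH]; simpl; [ring|]. rewrite IH; ring. Qed.

Lemma rsum_plus l f g : rsum l (fun x => f x + g x) = rsum l f + rsum l g.
Proof. induction l as [|x l IH]; simpl; [ring|]. rewrite IH; ring. Qed.

Lemma rsum_scal l k f : rsum l (fun x => k * f x) = k * rsum l f.
Proof. induction l as [|x l IH]; simpl; [ring|]. rewrite IH; ring. Qed.

Lemma rsum_0 l : rsum l (fun _ => 0) = 0.
Proof. induction l as [|x l IH]; simpl; [easy|]. rewrite IH; ring. Qed.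

Lemma rsum_ge0 l f : (forall x, In x l -> 0 <= f x) -> 0 <= rsum l f.
Proof. intros H. rewrite <- (rsum_0 l). now apply rsum_le. Qed.

Lemma rsum_ge_term l f x : (forall y, In y l -> 0 <= f y) -> In x l -> f x <= rsum l f.
Proof.
  induction l as [|z l IH]; simpl; intros H; [easy|].
  intros [<-|Hx].
  - assert (0 <= rsum l f) by (apply rsum_ge0; auto). lra.
  - assert (0 <= f z) by auto. assert (f x <= rsum l f) by auto. lra.
Qed.

Lemma pos_rsum_le l f : pos_part (rsum l f) <= rsum l (fun x => pos_part (f x)).
Proof.
  apply pos_le.
  - apply rsum_ge0; intros; apply pos_ge0.
  - apply rsum_le; intros; apply pos_ge.
Qed.
End Rsum.

Lemma rsum_map {A B} (h : A -> B) l f : rsum (map h l) f = rsum l (fun x => f (h x)).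
Proof. induction l as [|x l IH]; simpl; [easy|]. now rewrite IH. Qed.

Lemma rsum_flat_map {A B} (h : A -> list B) l f :
  rsum (flat_map h l) f = rsum l (fun x => rsum (h x) f).
Proof. induction l as [|x l IH]; simpl; [easy|]. now rewrite rsum_app, IH. Qed.

Lemma rsum_swap {A B} (l : list A) (l' : list B) f :
  rsum l (fun x => rsum l' (f x)) = rsum l' (fun y => rsum l (fun x => f x y)).
Proof.
  induction l as [|x l IH]; simpl; [now rewrite rsum_0|].
  now rewrite IH, rsum_plus.
Qed.

Lemma rsum_tuples_S q m f :
  rsum (tuples q (S m)) f = rsum (seq 0 q) (fun c => rsum (tuples q m) (fun x => f (c :: x))).
Proof.
  simpl. rewrite rsum_flat_map. apply rsum_ext; intros c _. apply rsum_map.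
Qed.

Lemma In_tuples_cons q m c x :
  In (c :: x) (tuples q (S m)) -> (c < q)%nat /\ In x (tuples q m).
Proof.
  simpl. rewrite in_flat_map. intros (d & Hd & H).
  apply in_map_iff in H. destruct H as (y & E & Hy). injection E as -> ->.
  apply in_seq in Hd. split; [lia|easy].
Qed.

Lemma In_tuples_length q m x : In x (tuples q m) -> length x = m.
Proof.
  revert x; induction m as [|m IH]; simpl; intros x.
  - now intros [<-|[]].
  - rewrite in_flat_map. intros (d & _ & H). apply in_map_iff in H.
    destruct H as (y & <- & Hy). simpl. now rewrite IH.
Qed.

(** * Chernoff bound for a finite distribution *)

(** From [exp (- y) >= 1 - y] one gets [exp y * (1 - y) <= 1], while [(1 + y + 2 y^2) (1 - y) = 1 +
    y^2 (1 - 2 y)] is at least 1 for [y <= 1/2]. *)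
Lemma exp_quad_bound y : y <= / 2 -> exp y <= 1 + y + 2 * y ^ 2.
Proof.
  intros Hy.
  assert (H1 : 1 - y <= exp (- y)) by (pose proof (exp_ineq1_le (- y)); lra).
  rewrite exp_Ropp in H1.
  assert (Hp := exp_pos y).
  assert (H2 : exp y * (1 - y) <= 1).
  { apply Rmult_le_compat_l with (r := exp y) in H1; [|lra].
    rewrite Rinv_r in H1; lra. }
  assert (H3 : 1 <= (1 + y + 2 * y ^ 2) * (1 - y)).
  { replace ((1 + y + 2 * y ^ 2) * (1 - y)) with (1 + y ^ 2 * (1 - 2 * y)) by ring.
    assert (0 <= y ^ 2 * (1 - 2 * y)) by (apply Rmult_le_pos; [apply pow2_ge_0|lra]).
    lra. }
  apply Rmult_le_reg_r with (1 - y); lra.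
Qed.

Section Chernoff.
Context {A : Type} (l : list A) (w f : A -> R).

(* The mean of [phi (s + f x_1 + ... + f x_T)] for independent [x_j] of law [w]. *)
Fixpoint iter_mean (phi : R -> R) (T : nat) (s : R) : R :=
  match T with
  | O => phi s
  | S T => rsum l (fun x => w x * iter_mean phi T (s + f x))
  end.

Hypothesis w_ge0 : forall x, In x l -> 0 <= w x.
Hypothesis w_sum : rsum l w = 1.

Lemma iter_mean_le phi psi T s :
  (forall s, phi s <= psi s) -> iter_mean phi T s <= iter_mean psi T s.
Proof.
  intros H; revert s; induction T as [|T IH]; simpl; intros s; auto.
  apply rsum_le; intros x Hx. apply Rmult_le_compat_l; auto.
Qed.

Lemma iter_mean_1 T s : iter_mean (fun _ => 1) T s = 1.
Proof.
  revert s; induction T as [|T IH]; simpl; intros s; [easy|].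
  transitivity (rsum l w); [|easy]. apply rsum_ext; intros x _. rewrite IH; ring.
Qed.

Definition mgf (t : R) : R := rsum l (fun x => w x * exp (t * f x)).

(** Both tails are carried by one test function: a draw multiplies each exponential by its moment
    generating function and, since the weights sum to 1, preserves the constant. *)
Lemma iter_mean_exp T s t u b c :
  iter_mean (fun s => 1 - b * exp (t * s) - c * exp (u * s)) T s =
  1 - b * mgf t ^ T * exp (t * s) - c * mgf u ^ T * exp (u * s).
Proof.
  revert s; induction T as [|T IH]; simpl; intros s; [ring|].
  transitivity (rsum l (fun x => w x + (- (b * mgf t ^ T * exp (t * s))) * (w x * exp (t * f x))
    + (- (c * mgf u ^ T * exp (u * s))) * (w x * exp (u * f x)))).
  - apply rsum_ext; intros x _. rewrite IH, !Rmult_plus_distr_l, !exp_plus. ring.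
  - rewrite !rsum_plus, !rsum_scal, w_sum. fold (mgf t) (mgf u). ring.
Qed.

Hypothesis f_01 : forall x, In x l -> 0 <= f x <= 1.

(** On [0,1] one has [f^2 <= f], so the quadratic bound becomes linear in [f] and the exponent
    scales with the mean. This is what yields a relative error. *)
Lemma mgf_le t : - / 2 <= t <= / 2 ->
  mgf t <= exp ((t + 2 * t ^ 2) * rsum l (fun x => w x * f x)).
Proof.
  intros Ht.
  apply Rle_trans with (1 + (t + 2 * t ^ 2) * rsum l (fun x => w x * f x));
    [|apply exp_ineq1_le].
  rewrite <- w_sum at 1. rewrite <- rsum_scal, <- rsum_plus.
  apply rsum_le; intros x Hx.
  assert (H := f_01 x Hx). assert (Hw := w_ge0 x Hx).
  assert (E : exp (t * f x) <= 1 + t * f x + 2 * (t * f x) ^ 2).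
  { apply exp_quad_bound. nra. }
  assert (0 <= 2 * t ^ 2 * (f x * (1 - f x))).
  { apply Rmult_le_pos; [pose proof (pow2_ge_0 t); lra|apply Rmult_le_pos; lra]. }
  replace (w x + (t + 2 * t ^ 2) * (w x * f x))
    with (w x * (1 + (t + 2 * t ^ 2) * f x)) by ring.
  apply Rmult_le_compat_l; [easy|]. nra.
Qed.

Lemma mgf_ge0 t : 0 <= mgf t.
Proof.
  apply rsum_ge0; intros x Hx. apply Rmult_le_pos; auto. left; apply exp_pos.
Qed.

Lemma exp_pow x T : exp x ^ T = exp (INR T * x).
Proof.
  induction T as [|T IH]; [now rewrite Rmult_0_l, exp_0|].
  simpl pow. rewrite IH, <- exp_plus, S_INR. f_equal; ring.
Qed.

(** [phi] dominates 1 minus two exponentials: inside the window both are positive and [phi] is at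
    least 1; outside it one of them is at least 1 and [phi] is non-negative. *)
Lemma chernoff phi T eps mu :
  mu = rsum l (fun x => w x * f x) -> 0 < eps < 1 ->
  (forall s, 0 <= phi s) ->
  (forall s, (1 - eps) * (INR T * mu) <= s <= (1 + eps) * (INR T * mu) -> 1 <= phi s) ->
  1 - 2 * exp (- (INR T * mu * eps ^ 2 / 8)) <= iter_mean phi T 0.
Proof.
  intros Hmu He Hphi0 Hphi.
  (* Per unit of [m], both tails have the exponent [2 t^2 - t eps]; [t = eps / 4] minimises it, with
     value [- eps^2 / 8], and respects [t <= 1/2]. *)
  set (t := eps / 4). set (m := INR T * mu).
  set (b := exp (- (t * ((1 + eps) * m)))). set (c := exp (t * ((1 - eps) * m))).
  apply Rle_trans with
    (iter_mean (fun s => 1 - b * exp (t * s) - c * exp (- t * s)) T 0).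
  - rewrite iter_mean_exp.
    assert (Hb : b * mgf t ^ T * exp (t * 0) <= exp (- (m * eps ^ 2 / 8))).
    { apply Rle_trans with (b * exp ((t + 2 * t ^ 2) * mu) ^ T * exp (t * 0)).
      - apply Rmult_le_compat_r; [left; apply exp_pos|].
        apply Rmult_le_compat_l; [left; apply exp_pos|].
        apply pow_incr; split; [apply mgf_ge0|].
        rewrite Hmu; apply mgf_le; unfold t; lra.
      - right. unfold b. rewrite exp_pow, <- !exp_plus. f_equal. unfold t, m. field. }
    assert (Hc : c * mgf (- t) ^ T * exp (- t * 0) <= exp (- (m * eps ^ 2 / 8))).
    { apply Rle_trans with (c * exp ((- t + 2 * (- t) ^ 2) * mu) ^ T * exp (- t * 0)).
      - apply Rmult_le_compat_r; [left; apply exp_pos|].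
        apply Rmult_le_compat_l; [left; apply exp_pos|].
        apply pow_incr; split; [apply mgf_ge0|].
        rewrite Hmu; apply mgf_le; unfold t; lra.
      - right. unfold c. rewrite exp_pow, <- !exp_plus. f_equal. unfold t, m. field. }
    unfold m in *. lra.
  - apply iter_mean_le; intros s.
    assert (Hb : 0 < b * exp (t * s)) by (apply Rmult_lt_0_compat; apply exp_pos).
    assert (Hc : 0 < c * exp (- t * s)) by (apply Rmult_lt_0_compat; apply exp_pos).
    destruct (Rle_dec ((1 - eps) * m) s) as [H1|H1];
      [destruct (Rle_dec s ((1 + eps) * m)) as [H2|H2]|].
    + specialize (Hphi s (conj H1 H2)). lra.
    + assert (1 <= b * exp (t * s)); [|specialize (Hphi0 s); lra].
      unfold b. rewrite <- exp_plus. eapply Rle_trans; [|apply exp_ineq1_le].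
      assert (0 < t * (s - (1 + eps) * m)); [|lra].
      apply Rmult_lt_0_compat; unfold t; lra.
    + assert (1 <= c * exp (- t * s)); [|specialize (Hphi0 s); lra].
      unfold c. rewrite <- exp_plus. eapply Rle_trans; [|apply exp_ineq1_le].
      assert (0 < t * ((1 - eps) * m - s)); [|lra].
      apply Rmult_lt_0_compat; unfold t; lra.
Qed.
End Chernoff.

(** * The sampling distribution *)

Section Proposal.
Variables (q : nat) (P Q : nat -> nat -> R).

Definition excess (i c : nat) : R := pos_part (P i c - Q i c).

(** On probability vectors this is the sum of the distances dTV(P_j, Q_j) over the [m] rows from [i]
    on, hence the mass of [mixture]. *)
Fixpoint total (m i : nat) : R :=
  match m with
  | O => 0
  | S m => rsum (seq 0 q) (excess i) + total m (S i)
  end.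

Fixpoint suffix_prob (R0 : nat -> nat -> R) (i : nat) (x : list nat) : R :=
  match x with
  | [] => 1
  | c :: x => R0 i c * suffix_prob R0 (S i) x
  end.

(* sum over j of (excess at j) * (product of P over the other coordinates) *)
Fixpoint mixture (i : nat) (x : list nat) : R :=
  match x with
  | [] => 0
  | c :: x => excess i c * suffix_prob P (S i) x + P i c * mixture (S i) x
  end.

(* One run of the sequential sampler from row [i]; [a], [h], [e] are the prefix
   values of prod P, of the mixture and of prod Q. *)
Fixpoint sampler (V : R -> R -> R -> R) (m i : nat) (a h e : R) : R :=
  match m with
  | O => V a h e
  | S m => rsum (seq 0 q) (fun c =>
      (excess i c * a + (a * total m (S i) + h) * P i c) / (a * total (S m) i + h) *
      sampler V m (S i) (a * P i c) (h * P i c + a * excess i c) (e * Q i c))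
  end.

Lemma prod_prob_suffix R0 x : prod_prob R0 x = suffix_prob R0 0 x.
Proof.
  unfold prod_prob.
  (* [nth] keeps reading the whole list while the induction consumes it, so the claim is generalised
     to a list [k] that agrees with [x] from position [i] on. *)
  enough (H : forall k i, (forall j, (j < length x)%nat -> nth j x O = nth (i + j) k O) ->
    fold_right Rmult 1 (map (fun i => R0 i (nth i k O)) (seq i (length x))) =
    suffix_prob R0 i x).
  { now apply (H x O). }
  induction x as [|c x IH]; intros k i H; [easy|].
  simpl. f_equal.
  - f_equal. specialize (H O). rewrite Nat.add_0_r in H. rewrite <- H; simpl; [easy|lia].
  - apply IH; intros j Hj. specialize (H (S j)). simpl in H.
    rewrite H by lia. f_equal; lia.
Qed.

Lemma excess_ge0 i c : 0 <= excess i c.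
Proof. apply pos_ge0. Qed.

Lemma total_ge0 m i : 0 <= total m i.
Proof.
  revert i; induction m as [|m IH]; simpl; intros i; [lra|].
  apply Rplus_le_le_0_compat; [|easy].
  apply rsum_ge0; intros; apply excess_ge0.
Qed.

(** A window of rows instead of an initial segment, so that inductions over suffixes can drop the
    first row. *)
Definition marginal_rows (m i : nat) (R0 : nat -> nat -> R) : Prop :=
  forall j, (i <= j < i + m)%nat ->
    (forall c, (c < q)%nat -> 0 <= R0 j c) /\ rsum (seq 0 q) (R0 j) = 1.

Lemma marginal_rows_S m i R0 :
  marginal_rows (S m) i R0 ->
  marginal_rows m (S i) R0 /\ (forall c, In c (seq 0 q) -> 0 <= R0 i c) /\
  rsum (seq 0 q) (R0 i) = 1.
Proof.
  intros H; split; [|split].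
  - intros j Hj; apply H; lia.
  - intros c Hc. apply in_seq in Hc. apply H; lia.
  - apply H; lia.
Qed.

Lemma suffix_prob_ge0 R0 m i x :
  marginal_rows m i R0 -> In x (tuples q m) -> 0 <= suffix_prob R0 i x.
Proof.
  revert i x; induction m as [|m IH]; intros i x H Hx.
  - destruct Hx as [<-|[]]; simpl; lra.
  - destruct x as [|c x]; [apply In_tuples_length in Hx; easy|].
    apply In_tuples_cons in Hx as [Hc Hx].
    apply marginal_rows_S in H as (H & H0 & _). simpl.
    apply Rmult_le_pos; [apply H0, in_seq; lia|auto].
Qed.

Lemma suffix_prob_sum R0 m i :
  marginal_rows m i R0 -> rsum (tuples q m) (suffix_prob R0 i) = 1.
Proof.
  revert i; induction m as [|m IH]; intros i H; [simpl; ring|].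
  apply marginal_rows_S in H as (H & _ & H1).
  rewrite rsum_tuples_S, <- H1. apply rsum_ext; intros c _. simpl.
  rewrite rsum_scal, IH by easy. ring.
Qed.

Lemma mixture_ge0 m i x :
  marginal_rows m i P -> In x (tuples q m) -> 0 <= mixture i x.
Proof.
  revert i x; induction m as [|m IH]; intros i x H Hx.
  - destruct Hx as [<-|[]]; simpl; lra.
  - destruct x as [|c x]; [apply In_tuples_length in Hx; easy|].
    apply In_tuples_cons in Hx as [Hc Hx].
    apply marginal_rows_S in H as (H & H0 & _). simpl.
    apply Rplus_le_le_0_compat; apply Rmult_le_pos.
    + apply excess_ge0.
    + now apply suffix_prob_ge0 with m.
    + apply H0, in_seq; lia.
    + auto.
Qed.

Lemma mixture_sum m i :
  marginal_rows m i P -> rsum (tuples q m) (mixture i) = total m i.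
Proof.
  revert i; induction m as [|m IH]; intros i H; [simpl; ring|].
  apply marginal_rows_S in H as (H & _ & H1).
  rewrite rsum_tuples_S. simpl.
  rewrite (rsum_ext _ _ (fun c => excess i c + total m (S i) * P i c)).
  - rewrite rsum_plus, rsum_scal, H1. unfold total; fold total. ring.
  - intros c _. rewrite rsum_plus, !rsum_scal, suffix_prob_sum, IH by easy. ring.
Qed.

(** Multiplying by the mass [a * total m i + h] of all suffixes clears the normalisations: the
    product of the conditional weights telescopes to the mass of a single tuple. *)
Lemma sampler_mean V m i a h e :
  marginal_rows m i P -> 0 <= a -> 0 <= h -> 0 < a * total m i + h ->
  (a * total m i + h) * sampler V m i a h e =
  rsum (tuples q m) (fun x => (h * suffix_prob P i x + a * mixture i x) *
    V (a * suffix_prob P i x) (h * suffix_prob P i x + a * mixture i x)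
      (e * suffix_prob Q i x)).
Proof.
  revert i a h e; induction m as [|m IH]; intros i a h e HP Ha Hh Hpos.
  - simpl. rewrite !Rmult_0_r, !Rmult_1_r, !Rplus_0_r, Rplus_0_l. ring.
  - pose proof HP as HP'. apply marginal_rows_S in HP' as (HP' & H0 & H1).
    rewrite rsum_tuples_S. simpl sampler. rewrite <- rsum_scal.
    apply rsum_ext; intros c Hc.
    set (a' := a * P i c). set (h' := h * P i c + a * excess i c).
    assert (Hx := excess_ge0 i c). specialize (H0 c Hc).
    assert (Ha' : 0 <= a') by (unfold a'; nra).
    assert (Hh' : 0 <= h') by (unfold h'; nra).
    assert (HT := total_ge0 m (S i)).
    change (rsum (seq 0 q) (excess i) + total m (S i)) with (total (S m) i).
    (* The numerator of the weight of [c] is the mass of the next state. *)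
    transitivity ((a' * total m (S i) + h') * sampler V m (S i) a' h' (e * Q i c)).
    { unfold a', h'. field. lra. }
    transitivity (rsum (tuples q m) (fun x =>
      (h' * suffix_prob P (S i) x + a' * mixture (S i) x) *
      V (a' * suffix_prob P (S i) x) (h' * suffix_prob P (S i) x + a' * mixture (S i) x)
        (e * Q i c * suffix_prob Q (S i) x))).
    2:{ apply rsum_ext; intros x _. simpl. unfold a', h'.
        f_equal; [ring|f_equal; ring]. }
    (* If the next state has mass 0, the induction hypothesis does not apply, but every term is
       non-negative with sum 0, so both sides vanish. *)
    destruct (Rle_lt_or_eq_dec 0 (a' * total m (S i) + h')) as [Hlt|Heq]; [nra| |].
    + now apply IH.
    + rewrite <- Heq, Rmult_0_l. symmetry.
      rewrite (rsum_ext _ _ (fun _ => 0)); [apply rsum_0|].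
      intros x Hx'.
      set (g := fun x => h' * suffix_prob P (S i) x + a' * mixture (S i) x).
      assert (Hg : forall y, In y (tuples q m) -> 0 <= g y).
      { intros y Hy. apply Rplus_le_le_0_compat; apply Rmult_le_pos; auto.
        - now apply suffix_prob_ge0 with m.
        - now apply mixture_ge0 with m. }
      assert (Hs : rsum (tuples q m) g = 0).
      { unfold g. rewrite rsum_plus, !rsum_scal, suffix_prob_sum, mixture_sum by easy. lra. }
      assert (g x <= 0) by (rewrite <- Hs; now apply rsum_ge_term).
      specialize (Hg x Hx'). fold (g x). replace (g x) with 0 by lra. ring.
Qed.

(** Induction on the signed difference, with [A], [B], [M] the suffix values: if Q_i(c) <= P_i(c),
    split off (P - Q) A and bound A - B by [M]; otherwise P A - Q B <= P (A - B). *)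
Lemma pos_le_mixture m i x :
  marginal_rows m i P -> marginal_rows m i Q -> In x (tuples q m) ->
  pos_part (suffix_prob P i x - suffix_prob Q i x) <= mixture i x.
Proof.
  intros HP HQ Hx. apply pos_le; [now apply mixture_ge0 with m|].
  revert i x HP HQ Hx; induction m as [|m IH]; intros i x HP HQ Hx.
  - destruct Hx as [<-|[]]; simpl; lra.
  - destruct x as [|c x]; [apply In_tuples_length in Hx; easy|].
    apply In_tuples_cons in Hx as [Hc Hx].
    apply marginal_rows_S in HP as (HP & HP0 & _).
    apply marginal_rows_S in HQ as (HQ & HQ0 & _). simpl.
    specialize (HP0 c ltac:(apply in_seq; lia)). specialize (HQ0 c ltac:(apply in_seq; lia)).
    specialize (IH (S i) x HP HQ Hx).
    assert (Hm := mixture_ge0 m (S i) x HP Hx).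
    assert (HSP := suffix_prob_ge0 P m (S i) x HP Hx).
    assert (HSQ := suffix_prob_ge0 Q m (S i) x HQ Hx).
    assert (Hex := excess_ge0 i c). assert (Hex' : P i c - Q i c <= excess i c) by apply pos_ge.
    revert IH Hm HSP HSQ.
    generalize (suffix_prob P (S i) x) (suffix_prob Q (S i) x) (mixture (S i) x).
    intros A B M; intros.
    (* P A - Q B = (P - Q) A + Q (A - B) *)
    destruct (Rle_dec B A); destruct (Rle_dec (Q i c) (P i c)); nra.
Qed.

(** * Comparison of [total] with the total variation distance *)

Definition pos_diff (m i : nat) (a e : R) : R :=
  rsum (tuples q m) (fun x => pos_part (a * suffix_prob P i x - e * suffix_prob Q i x)).

(** The scalars [a] and [e] exist to absorb the first coordinate here. *)
Lemma pos_diff_S m i a e :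
  pos_diff (S m) i a e = rsum (seq 0 q) (fun c => pos_diff m (S i) (a * P i c) (e * Q i c)).
Proof.
  unfold pos_diff. rewrite rsum_tuples_S. apply rsum_ext; intros c _.
  apply rsum_ext; intros x _. simpl. f_equal; ring.
Qed.

(** The positive part is subadditive, and both suffix laws have mass 1. *)
Lemma pos_diff_ge m i a e :
  marginal_rows m i P -> marginal_rows m i Q -> pos_part (a - e) <= pos_diff m i a e.
Proof.
  intros HP HQ. unfold pos_diff. eapply Rle_trans; [|apply pos_rsum_le]. right. f_equal.
  rewrite (rsum_ext _ _ (fun x => a * suffix_prob P i x + - e * suffix_prob Q i x))
    by (intros; ring).
  rewrite rsum_plus, !rsum_scal, !suffix_prob_sum by easy. ring.
Qed.

(** Data processing for the projection onto the first coordinate. *)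
Lemma pos_diff_row m i :
  marginal_rows (S m) i P -> marginal_rows (S m) i Q ->
  rsum (seq 0 q) (excess i) <= pos_diff (S m) i 1 1.
Proof.
  intros HP HQ. apply marginal_rows_S in HP as (HP & _). apply marginal_rows_S in HQ as (HQ & _).
  rewrite pos_diff_S. apply rsum_le; intros c _. unfold excess.
  rewrite !Rmult_1_l. now apply pos_diff_ge.
Qed.

(** Data processing for the projection that forgets the first coordinate: the sum over [c] is moved
    inside the positive part. *)
Lemma pos_diff_tail m i :
  marginal_rows (S m) i P -> marginal_rows (S m) i Q ->
  pos_diff m (S i) 1 1 <= pos_diff (S m) i 1 1.
Proof.
  intros HP HQ. apply marginal_rows_S in HP as (HP & _ & HP1).
  apply marginal_rows_S in HQ as (HQ & _ & HQ1).
  unfold pos_diff. rewrite rsum_tuples_S, rsum_swap.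
  apply rsum_le; intros x _. simpl.
  eapply Rle_trans; [|apply pos_rsum_le]. right. f_equal.
  rewrite (rsum_ext _ _ (fun c => suffix_prob P (S i) x * P i c +
    - suffix_prob Q (S i) x * Q i c)) by (intros; ring).
  rewrite rsum_plus, !rsum_scal, HP1, HQ1. ring.
Qed.

(** By data processing each of the [m] rows contributes at most the joint distance. This bounds the
    mean of the ratio below by 1/n, whence the factor [n] in the number of samples. *)
Lemma total_le_pos_diff m i :
  marginal_rows m i P -> marginal_rows m i Q -> total m i <= INR m * pos_diff m i 1 1.
Proof.
  revert i; induction m as [|m IH]; intros i HP HQ; [simpl; lra|].
  assert (H1 := pos_diff_row m i HP HQ). assert (H2 := pos_diff_tail m i HP HQ).
  apply marginal_rows_S in HP as (HP & _). apply marginal_rows_S in HQ as (HQ & _).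
  specialize (IH (S i) HP HQ). assert (Hm := pos_INR m).
  rewrite S_INR. simpl total. nra.
Qed.

(** The pointwise domination, summed. It shows that the distance is 0 when [total] is 0. *)
Lemma pos_diff_le_total m i :
  marginal_rows m i P -> marginal_rows m i Q -> pos_diff m i 1 1 <= total m i.
Proof.
  intros HP HQ. rewrite <- mixture_sum by easy.
  apply rsum_le; intros x Hx. rewrite !Rmult_1_l. now apply pos_le_mixture with m.
Qed.

Lemma is_marginals_rows n R0 : is_marginals q n R0 <-> marginal_rows n 0 R0.
Proof. split; intros H i Hi; apply H; lia. Qed.

(** In |x| = 2 x^+ - x the linear terms cancel in the sum, since both products have mass 1. *)
Lemma dTV_pos_diff n :
  is_marginals q n P -> is_marginals q n Q -> dTV q n P Q = pos_diff n 0 1 1.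
Proof.
  intros HP HQ. apply is_marginals_rows in HP, HQ. unfold dTV, pos_diff.
  rewrite (rsum_ext _ _ (fun x => 2 * pos_part (1 * suffix_prob P 0 x - 1 * suffix_prob Q 0 x)
    + ((-1) * suffix_prob P 0 x + suffix_prob Q 0 x))).
  - rewrite !rsum_plus, !rsum_scal, !suffix_prob_sum by easy. field.
  - intros x _. rewrite Rabs_pos, !prod_prob_suffix, !Rmult_1_l. ring.
Qed.

Definition proposal (n : nat) (x : list nat) : R := mixture 0 x / total n 0.

Definition ratio (x : list nat) : R :=
  pos_part (suffix_prob P 0 x - suffix_prob Q 0 x) / mixture 0 x.

Definition sample_ratio (V : R -> R) (n : nat) : R :=
  sampler (fun a h e => V (pos_part (a - e) / h)) n 0 1 0 1.

Section Marginals.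
Variable n : nat.
Hypothesis HP : is_marginals q n P.
Hypothesis HQ : is_marginals q n Q.
Hypothesis Hn : 0 < total n 0.

(** Started from [a = 1], [h = 0], [e = 1], the prefix values of a finished run are P(x),
    [mixture 0 x] and Q(x). *)
Lemma sample_ratio_mean V :
  sample_ratio V n = rsum (tuples q n) (fun x => proposal n x * V (ratio x)).
Proof.
  unfold sample_ratio.
  apply Rmult_eq_reg_l with (1 * total n 0 + 0); [|lra].
  rewrite sampler_mean; [|now apply is_marginals_rows|lra..].
  rewrite <- rsum_scal. apply rsum_ext; intros x _. unfold proposal, ratio.
  rewrite !Rmult_1_l, !Rmult_0_l, !Rplus_0_l. field. lra.
Qed.

Lemma proposal_ge0 x : In x (tuples q n) -> 0 <= proposal n x.
Proof.
  intros Hx. apply Rmult_le_pos; [|left; now apply Rinv_0_lt_compat].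
  apply mixture_ge0 with n; [now apply is_marginals_rows|easy].
Qed.

Lemma proposal_sum : rsum (tuples q n) (proposal n) = 1.
Proof.
  unfold proposal.
  rewrite (rsum_ext _ _ (fun x => / total n 0 * mixture 0 x)) by (intros; apply Rmult_comm).
  rewrite rsum_scal, mixture_sum by now apply is_marginals_rows.
  apply Rinv_l; lra.
Qed.

Lemma ratio_01 x : In x (tuples q n) -> 0 <= ratio x <= 1.
Proof.
  intros Hx. unfold ratio.
  assert (H := pos_le_mixture n 0 x (proj1 (is_marginals_rows _ _) HP)
    (proj1 (is_marginals_rows _ _) HQ) Hx).
  revert H. assert (H0 := pos_ge0 (suffix_prob P 0 x - suffix_prob Q 0 x)).
  revert H0. generalize (pos_part (suffix_prob P 0 x - suffix_prob Q 0 x)) (mixture 0 x).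
  intros u v Hu Huv. destruct (Req_dec v 0) as [E|E].
  (* Where [mixture] vanishes, so does the numerator, and the quotient is 0 whatever the inverse of
     0 is. *)
  - replace u with 0 by lra. unfold Rdiv. lra.
  - split; [apply Rmult_le_pos; [easy|left; apply Rinv_0_lt_compat; lra]|].
    apply Rmult_le_reg_r with v; [lra|]. unfold Rdiv.
    rewrite Rmult_assoc, Rinv_l; lra.
Qed.

Lemma ratio_mean :
  rsum (tuples q n) (fun x => proposal n x * ratio x) = dTV q n P Q / total n 0.
Proof.
  rewrite dTV_pos_diff by easy. unfold pos_diff, Rdiv. rewrite Rmult_comm, <- rsum_scal.
  apply rsum_ext; intros x Hx. unfold proposal, ratio. rewrite !Rmult_1_l.
  assert (H := pos_le_mixture n 0 x (proj1 (is_marginals_rows _ _) HP)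
    (proj1 (is_marginals_rows _ _) HQ) Hx).
  assert (H0 := pos_ge0 (suffix_prob P 0 x - suffix_prob Q 0 x)).
  destruct (Req_dec (mixture 0 x) 0) as [E|E].
  - replace (pos_part _) with 0 by lra. unfold Rdiv; ring.
  - field. lra.
Qed.

Lemma sampler_chernoff phi T eps :
  0 < eps < 1 -> (forall s, 0 <= phi s) ->
  (forall s, (1 - eps) * (INR T * (dTV q n P Q / total n 0)) <= s
    <= (1 + eps) * (INR T * (dTV q n P Q / total n 0)) -> 1 <= phi s) ->
  1 - 2 * exp (- (INR T * (dTV q n P Q / total n 0) * eps ^ 2 / 8)) <=
  iter_mean (tuples q n) (proposal n) ratio phi T 0.
Proof.
  intros He H0 H. apply chernoff; auto.
  - apply proposal_ge0.
  - apply proposal_sum.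
  - apply ratio_01.
  - now rewrite ratio_mean.
Qed.
End Marginals.
End Proposal.

(** * Lower bounds on the machine semantics *)

Section Run.
Variables (q : nat) (pg : list instr).

Definition deterministic (i : instr) : Prop :=
  match i with Sample _ _ | Halt => False | _ => True end.

Lemma run_det i f G p I M :
  nth_error pg p = Some i -> deterministic i ->
  run q pg (S f) G (mkState p I M) = run q pg f G (exec_det i (mkState p I M)).
Proof. intros H Hd. simpl. rewrite H. destruct i; easy. Qed.

Lemma valid_weights_spec w :
  valid_weights q w = true <->
  (forall c, In c (seq 0 q) -> 0 <= w c) /\ rsum (seq 0 q) w = 1.
Proof.
  unfold valid_weights. rewrite Bool.andb_true_iff, forallb_forall.
  destruct (Req_EM_T (rsum (seq 0 q) w) 1) as [E|E].
  - split; intros [H _]; (split; [|easy]); intros c Hc; specialize (H c Hc);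
      now destruct (Rle_dec 0 (w c)).
  - split; intros [_ H]; easy.
Qed.

(** Running out of fuel pays 0, so further fuel only adds non-negative contributions. *)
Lemma run_bounds (G G' : R -> R) f f' s :
  (f <= f')%nat -> (forall x, 0 <= G x <= G' x) ->
  0 <= run q pg f G s <= run q pg f' G' s.
Proof.
  intros Hf HG. revert f' s Hf; induction f as [|f IH]; intros f' s Hf.
  - split; [simpl; lra|]. clear Hf. revert s. change (forall s, 0 <= run q pg f' G' s).
    induction f' as [|f' IH]; intros s; simpl; [lra|].
    destruct (nth_error pg (pc s)) as [[]|]; auto; try lra.
    + destruct (valid_weights _ _) eqn:E; [|lra].
      apply valid_weights_spec in E. apply rsum_ge0; intros c Hc.
      apply Rmult_le_pos; [now apply E|apply IH].
    + specialize (HG (rreg s 0)). simpl in *. lra.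
  - destruct f' as [|f']; [lia|]. apply le_S_n in Hf. simpl.
    destruct (nth_error pg (pc s)) as [[]|]; auto; try lra.
    destruct (valid_weights _ _) eqn:E; [|lra].
    apply valid_weights_spec in E. destruct E as [E _]. split.
    + apply rsum_ge0; intros c Hc. apply Rmult_le_pos; [now apply E|now apply (IH f')].
    + apply rsum_le; intros c Hc. apply Rmult_le_compat_l; [now apply E|now apply IH].
Qed.

(** With a matching lower bound, this gives halting with probability exactly 1. *)
Lemma run_le_1 f s : run q pg f (fun _ => 1) s <= 1.
Proof.
  revert s; induction f as [|f IH]; simpl; intros s; [lra|].
  destruct (nth_error pg (pc s)) as [[]|]; auto; try lra.
  destruct (valid_weights _ _) eqn:E; [|lra].
  apply valid_weights_spec in E. destruct E as [E E1].
  eapply Rle_trans; [|right; exact E1]. apply rsum_le; intros c Hc. rewrite <- Rmult_1_r.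
  apply Rmult_le_compat_l; [now apply E|easy].
Qed.

(** Reachability as an inequality of expected payoffs: [k] need only bound the number of steps, so
    branches of different lengths share one budget. *)
Definition reach (k : nat) (s s' : state) : Prop :=
  forall f G, (forall x, 0 <= G x) -> run q pg f G s' <= run q pg (k + f) G s.

Lemma reach_refl k s : reach k s s.
Proof.
  intros f G HG. apply run_bounds; [lia|]. intros x; split; [easy|lra].
Qed.

Lemma reach_trans k1 k2 k s1 s2 s3 :
  reach k1 s1 s2 -> reach k2 s2 s3 -> (k1 + k2 <= k)%nat -> reach k s1 s3.
Proof.
  intros H1 H2 Hk f G HG.
  eapply Rle_trans; [now apply H2|]. eapply Rle_trans; [now apply H1|].
  apply run_bounds; [lia|]. intros x; split; [easy|lra].
Qed.

Lemma reach_step i k p I M s :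
  nth_error pg p = Some i -> deterministic i ->
  reach k (exec_det i (mkState p I M)) s -> reach (S k) (mkState p I M) s.
Proof.
  intros H Hd Hr f G HG. simpl plus. rewrite (run_det i) by easy. now apply Hr.
Qed.

Lemma reach_run k k' f G v s s' :
  (forall x, 0 <= G x) -> reach k s s' -> (k + f <= k')%nat -> v <= run q pg f G s' ->
  v <= run q pg k' G s.
Proof.
  intros HG H Hk Hv. eapply Rle_trans; [exact Hv|]. eapply Rle_trans; [now apply H|].
  apply run_bounds; [lia|]. intros x; split; [easy|lra].
Qed.

Lemma run_sample d b f G p I M w v :
  nth_error pg p = Some (Sample d b) ->
  (forall c, (c < q)%nat -> M (I b + c)%nat = w c) ->
  (forall c, (c < q)%nat -> 0 <= w c) -> rsum (seq 0 q) w = 1 ->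
  v <= rsum (seq 0 q) (fun c => w c * run q pg f G (mkState (S p) (updn I d c) M)) ->
  v <= run q pg (S f) G (mkState p I M).
Proof.
  intros H HM H0 H1 Hv. simpl. rewrite H. cbn [ireg rreg].
  assert (Hw : forall c, In c (seq 0 q) -> M (I b + c)%nat = w c).
  { intros c Hc. apply HM. apply in_seq in Hc; lia. }
  replace (valid_weights _ _) with true.
  - rewrite (rsum_ext _ _ (fun c => w c * run q pg f G (mkState (S p) (updn I d c) M)));
      [easy|]. intros c Hc. now rewrite Hw.
  - symmetry. apply valid_weights_spec. split.
    + intros c Hc. rewrite Hw by easy. apply H0. apply in_seq in Hc; lia.
    + rewrite <- H1. now apply rsum_ext.
Qed.
End Run.

(** * The program *)

Definition jump (t : nat) : instr := IJle 1 1 t.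

(* Integer registers after the set-up (pc 0-25): 0 = n, 1 = 0, 2 = 1,
   3 = 2 + nq, 4 = q, 5 and 6 = addresses of the current cells of P and Q,
   7 = address of the current weight, 8 = end of the weights, 9 = sampled value,
   10 + j = B + j for j <= 14, where B = 2 + 2nq is the first free address.
   Real cells, relative to B: 0 = 0, 1 = 1, 2 = total, 3 = delta * 2^k,
   4 = target number of samples, 5 = samples drawn, 6 = accumulated ratios,
   7, 8, 9 = a, h, e of [sampler], 10 = remaining total, 11, 12 = temporaries,
   13 = normalisation of the weights, 14 + c = weights. *)
Definition prog (q : nat) : list instr :=
  [ (*  0 *) IConst 2 1; IConst 4 q;
    (*  2 *) IJle 4 9 6; IAdd 3 3 0; IAdd 9 9 2; jump 2;
    (*  6 *) IConst 10 2; IAdd 9 10 3; IAdd 10 9 3; IAdd 3 9 1;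
    (* 10 *) IAdd 11 10 2; IAdd 12 11 2; IAdd 13 12 2; IAdd 14 13 2; IAdd 15 14 2;
             IAdd 16 15 2; IAdd 17 16 2; IAdd 18 17 2; IAdd 19 18 2; IAdd 20 19 2;
             IAdd 21 20 2; IAdd 22 21 2; IAdd 23 22 2; IAdd 24 23 2;
    (* 24 *) IAdd 8 24 4; RConst 11 1; RJle 11 1 106;
    (* 27: total *)
             IConst 5 2; IAdd 6 3 1;
    (* 29 *) IJle 3 5 36; RArith RSub 21 5 6; RJle 21 10 33; RArith RAdd 12 12 21;
    (* 33 *) IAdd 5 5 2; IAdd 6 6 2; jump 29;
    (* 36 *) RJle 12 10 106;
    (* 37: target number (k+1) 8n/eps^2 of samples, where 2^k delta >= 1 *)
             RArith RAdd 13 10 2; RConst 21 8; RofI 22 0; RArith RMul 21 21 22;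
             RArith RDiv 21 21 1; RArith RDiv 21 21 1; RArith RAdd 14 21 10;
    (* 44 *) RJle 11 13 48; RArith RAdd 13 13 13; RArith RAdd 14 14 21; jump 44;
    (* 48: one sample *)
             RJle 14 15 102; RArith RAdd 15 15 11;
             RArith RAdd 17 11 10; RArith RAdd 18 10 10; RArith RAdd 19 11 10;
             RArith RAdd 20 12 10; IConst 5 2; IAdd 6 3 1;
    (* 56: one coordinate *)
             IJle 3 5 97; RArith RMul 23 17 20; RArith RAdd 23 23 18; IAdd 7 24 1;
    (* 60 *) IJle 8 7 69; RArith RSub 7 5 6; RJle 10 7 64; RArith RAdd 7 10 10;
    (* 64 *) RArith RSub 20 20 7; IAdd 5 5 2; IAdd 6 6 2; IAdd 7 7 2; jump 60;
    (* 69 *) ISub 5 5 4; ISub 6 6 4; IAdd 7 24 1;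
    (* 72 *) IJle 8 7 82; RArith RMul 21 17 20; RArith RAdd 21 21 18; RArith RMul 21 21 5;
             RArith RMul 7 7 17; RArith RAdd 7 7 21; RArith RDiv 7 7 23;
             IAdd 5 5 2; IAdd 7 7 2; jump 72;
    (* 82 *) Sample 9 24;
    (* 83: h is recovered from the identity h' + a' total' = weight * normalisation *)
             ISub 5 5 4; IAdd 5 5 9; IAdd 6 6 9; IAdd 7 24 9;
             RArith RMul 7 7 23; RArith RMul 17 17 5; RArith RMul 21 17 20;
             RArith RSub 18 7 21; RArith RMul 19 19 6;
    (* 92 *) ISub 5 5 9; ISub 6 6 9; IAdd 5 5 4; IAdd 6 6 4; jump 56;
    (* 97 *) RArith RSub 21 17 19; RJle 21 10 48; RArith RDiv 21 21 18;
             RArith RAdd 16 16 21; jump 48;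
    (* 102 *) RArith RMul 16 16 12; RArith RDiv 16 16 15; RArith RAdd 1 16 10; Halt;
    (* 106 *) RArith RSub 1 1 1; Halt ].

Lemma updr_eq f d v : updr f d v d = v.
Proof. unfold updr. now rewrite Nat.eqb_refl. Qed.

Lemma updr_neq f d v k : k <> d -> updr f d v k = f k.
Proof. intros H. unfold updr. now rewrite (proj2 (Nat.eqb_neq _ _)). Qed.

(** * Registers and memory during a run *)

Section Correctness.
Variables (q n : nat) (P Q : nat -> nat -> R) (eps delta : R).
Hypothesis hq : (1 <= q)%nat.

Definition base : nat := (2 + 2 * (n * q))%nat.

(** Only registers 5, 6, 7 and 9 change after the set-up; they are the parameters. *)
Definition ints (p5 p6 p7 p9 : nat) (k : nat) : nat :=
  if (k <? 10)%nat
  then nth k [n; 0; 1; 2 + n * q; q; p5; p6; p7; base + (14 + q); p9]%nat O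
  else if (k <? 25)%nat then (base + (k - 10))%nat else O.

(** The input cells keep their contents until the answer is written to cell 0; only the scratch part
    [F], addressed relative to [base], evolves. *)
Definition mem (F : nat -> R) (k : nat) : R :=
  if (k <? base)%nat then rreg (init q n P Q eps delta) k else F (k - base)%nat.

Lemma mem_scratch F j : mem F (base + j) = F j.
Proof.
  unfold mem. rewrite (proj2 (Nat.ltb_ge _ _)) by lia. f_equal; lia.
Qed.

Lemma mem_eps F : mem F 0 = eps.
Proof. easy. Qed.

Lemma mem_delta F : mem F 1 = delta.
Proof. easy. Qed.

Lemma cell_lt i c : (i < n)%nat -> (c < q)%nat -> (i * q + c < n * q)%nat.
Proof. intros. nia. Qed.

Lemma divmod_cell i c : (c < q)%nat ->
  ((i * q + c) / q = i /\ (i * q + c) mod q = c)%nat.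
Proof.
  intros Hc. rewrite Nat.add_comm. split.
  - rewrite Nat.div_add, Nat.div_small by lia. lia.
  - rewrite Nat.Div0.mod_add, Nat.mod_small by lia. lia.
Qed.

Lemma mem_P F i c : (i < n)%nat -> (c < q)%nat -> mem F (2 + (i * q + c)) = P i c.
Proof.
  intros Hi Hc. assert (H := cell_lt i c Hi Hc).
  destruct (divmod_cell i c Hc) as [E1 E2].
  unfold mem. rewrite (proj2 (Nat.ltb_lt _ _)) by (unfold base; lia).
  unfold init; cbn [rreg Nat.eqb Nat.add].
  rewrite (proj2 (Nat.ltb_lt _ _)) by lia.
  replace (S (S (i * q + c)) - 2)%nat with (i * q + c)%nat by lia.
  now rewrite E1, E2.
Qed.

Lemma mem_Q F i c :
  (i < n)%nat -> (c < q)%nat -> mem F (2 + n * q + (i * q + c)) = Q i c.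
Proof.
  intros Hi Hc. assert (H := cell_lt i c Hi Hc).
  destruct (divmod_cell i c Hc) as [E1 E2].
  unfold mem. rewrite (proj2 (Nat.ltb_lt _ _)) by (unfold base; lia).
  unfold init; cbn [rreg Nat.eqb Nat.add].
  rewrite (proj2 (Nat.ltb_ge _ _)) by lia.
  rewrite (proj2 (Nat.ltb_lt _ _)) by lia.
  replace (S (S (n * q + (i * q + c))) - 2 - n * q)%nat with (i * q + c)%nat by lia.
  now rewrite E1, E2.
Qed.

Lemma updr_mem F j v : updr (mem F) (base + j) v = mem (updr F j v).
Proof.
  apply functional_extensionality; intros k. unfold updr, mem.
  destruct (Nat.eqb_spec k (base + j)) as [->|Hk].
  - rewrite (proj2 (Nat.ltb_ge _ _)), (proj2 (Nat.eqb_eq _ _)) by lia. easy.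
  - destruct (Nat.ltb_spec k base); [easy|].
    now rewrite (proj2 (Nat.eqb_neq _ _)) by lia.
Qed.

Ltac regs := apply functional_extensionality; intros k; do 10 (destruct k; [reflexivity|]);
  reflexivity.

Lemma updn_5 p5 p6 p7 p9 v : updn (ints p5 p6 p7 p9) 5 v = ints v p6 p7 p9.
Proof. regs. Qed.
Lemma updn_6 p5 p6 p7 p9 v : updn (ints p5 p6 p7 p9) 6 v = ints p5 v p7 p9.
Proof. regs. Qed.
Lemma updn_7 p5 p6 p7 p9 v : updn (ints p5 p6 p7 p9) 7 v = ints p5 p6 v p9.
Proof. regs. Qed.
Lemma updn_9 p5 p6 p7 p9 v : updn (ints p5 p6 p7 p9) 9 v = ints p5 p6 p7 v.
Proof. regs. Qed.

Ltac look := cbn [exec_det jump pc ireg rreg eval_rop];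
  cbn [ints Nat.ltb Nat.leb nth Nat.sub];
  rewrite ?updn_5, ?updn_6, ?updn_7, ?updn_9, ?updr_mem, ?mem_scratch, ?mem_eps, ?mem_delta;
  repeat (rewrite updr_eq || rewrite updr_neq by lia).
Ltac step := eapply reach_step; [reflexivity|exact I|look].

Notation st p p5 p6 p7 p9 F := (mkState p (ints p5 p6 p7 p9) (mem F)).
Notation reach := (reach q (prog q)).

(** * Simulation of one coordinate of the sampler *)

Lemma pass1_cell i c F p9 : (i < n)%nat -> (c < q)%nat -> F 0%nat = 0 ->
  exists F',
    reach 9 (st 60 (2 + (i * q + c)) (2 + n * q + (i * q + c)) (base + (14 + c)) p9 F)%nat
     (st 60 (2 + (i * q + S c)) (2 + n * q + (i * q + S c)) (base + (14 + S c)) p9 F')%nat /\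
    (forall j, j <> 10%nat -> j <> (14 + c)%nat -> F' j = F j) /\
    F' 10%nat = F 10%nat - excess P Q i c /\ F' (14 + c)%nat = excess P Q i c.
Proof.
  intros Hi Hc H0. unfold excess.
  assert (E1 : (2 + (i * q + S c) = 2 + (i * q + c) + 1)%nat) by lia.
  assert (E2 : (2 + n * q + (i * q + S c) = 2 + n * q + (i * q + c) + 1)%nat) by lia.
  assert (E3 : (base + (14 + S c) = base + (14 + c) + 1)%nat) by lia.
  rewrite E1, E2, E3.
  destruct (Rle_dec 0 (P i c - Q i c)) as [Hs|Hs]; eexists; split.
  - step. rewrite (proj2 (Nat.leb_gt _ _)) by lia.
    step. rewrite mem_P, mem_Q by easy.
    step. rewrite H0. destruct (Rle_dec _ _); [|easy].
    do 5 step. apply reach_refl.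
  - rewrite pos_id by easy. repeat split; intros; now look.
  - step. rewrite (proj2 (Nat.leb_gt _ _)) by lia.
    step. rewrite mem_P, mem_Q by easy.
    step. rewrite H0. destruct (Rle_dec _ _); [easy|].
    do 6 step. apply reach_refl.
  - rewrite pos_0 by lra. repeat split; intros; look; rewrite ?H0; lra.
Qed.

(** The first pass stores the excesses of row [i] and subtracts them from cell 10, which then holds
    the total of the later rows, as the weights require. *)
Lemma pass1 i k c F p9 : (i < n)%nat -> (c + k = q)%nat -> F 0%nat = 0 ->
  exists F',
    reach (9 * k + 1) (st 60 (2 + (i * q + c)) (2 + n * q + (i * q + c)) (base + (14 + c)) p9 F)%nat
     (st 69 (2 + (i * q + q)) (2 + n * q + (i * q + q)) (base + (14 + q)) p9 F')%nat /\
    (forall j, j <> 10%nat -> (j < 14 + c)%nat -> F' j = F j) /\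
    F' 10%nat = F 10%nat - rsum (seq c k) (excess P Q i) /\
    (forall c', (c <= c' < q)%nat -> F' (14 + c')%nat = excess P Q i c').
Proof.
  intros Hi. revert c F; induction k as [|k IH]; intros c F Hck H0.
  - exists F. replace c with q by lia.
    split; [|repeat split; intros; simpl; try lia; ring_simplify; easy].
    step. rewrite Nat.leb_refl. apply reach_refl.
  - destruct (pass1_cell i c F p9) as (F1 & R1 & H1 & H2 & H3); [lia..|easy|].
    destruct (IH (S c) F1) as (F2 & R2 & H4 & H5 & H6); [lia|rewrite H1; easy|].
    exists F2. split; [eapply reach_trans; [exact R1|exact R2|lia]|].
    repeat split.
    + intros j Hj Hj'. rewrite H4, H1 by lia; easy.
    + rewrite H5, H2. simpl. ring.
    + intros c' Hc'. destruct (Nat.eq_dec c c') as [<-|]; [|apply H6; lia].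
      rewrite H4 by lia. easy.
Qed.

Definition weight (i : nat) (a h d den p : R) (c : nat) : R :=
  (p * a + (a * d + h) * P i c) / den.

(** The second pass replaces each stored excess by its weight in place; every cell is read before it
    is overwritten. *)
Lemma pass2 i k c F x6 p9 : (i < n)%nat -> (c + k = q)%nat ->
  exists F',
    reach (10 * k + 1) (st 72 (2 + (i * q + c)) x6 (base + (14 + c)) p9 F)%nat
     (st 82 (2 + (i * q + q)) x6 (base + (14 + q)) p9 F')%nat /\
    (forall j, j <> 11%nat -> (j < 14 + c)%nat -> F' j = F j) /\
    (forall c', (c <= c' < q)%nat -> F' (14 + c')%nat =
      weight i (F 7%nat) (F 8%nat) (F 10%nat) (F 13%nat) (F (14 + c')%nat) c').
Proof.
  intros Hi. revert c F; induction k as [|k IH]; intros c F Hck.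
  - exists F. replace c with q by lia. split; [|split; intros; [easy|lia]].
    step. rewrite Nat.leb_refl. apply reach_refl.
  - edestruct (IH (S c)) as (F2 & R2 & H4 & H6); [lia|].
    exists F2. split.
    + eapply reach_trans with (k1 := 10%nat); [|exact R2|lia].
      replace (2 + (i * q + S c))%nat with (2 + (i * q + c) + 1)%nat by lia.
      replace (base + (14 + S c))%nat with (base + (14 + c) + 1)%nat by lia.
      step. rewrite (proj2 (Nat.leb_gt _ _)) by lia.
      step. step. step. rewrite mem_P by (easy || lia).
      do 6 step. apply reach_refl.
    + split.
      * intros j Hj Hj'. rewrite H4 by lia. now look.
      * intros c' Hc'. destruct (Nat.eq_dec c c') as [<-|].
        -- rewrite H4 by lia. look. easy.
        -- rewrite H6 by lia. now look.
Qed.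

(** The normalisation in cell 13 involves the total with row [i] included, so it is computed before
    the first pass lowers cell 10. *)
Lemma coord_weights i F p7 p9 : (i < n)%nat -> F 0%nat = 0 ->
  exists F',
    reach (19 * q + 9) (st 56 (2 + i * q) (2 + n * q + i * q) p7 p9 F)%nat
     (st 82 (2 + (i * q + q)) (2 + n * q + i * q) (base + (14 + q)) p9 F')%nat /\
    (forall j, (j < 10)%nat -> F' j = F j) /\
    F' 10%nat = F 10%nat - rsum (seq 0 q) (excess P Q i) /\
    F' 13%nat = F 7%nat * F 10%nat + F 8%nat /\
    (forall c, (c < q)%nat -> F' (14 + c)%nat =
      weight i (F 7%nat) (F 8%nat) (F' 10%nat) (F' 13%nat) (excess P Q i c) c).
Proof.
  intros Hi H0.
  assert (Hq : (i * q + q <= n * q)%nat) by nia.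
  edestruct (pass1 i q 0) as (F1 & R1 & H1 & H2 & H3); [easy|lia| |].
  2:{ destruct (pass2 i q 0 F1 (2 + n * q + i * q) p9) as (F2 & R2 & H4 & H5); [easy|lia|].
  exists F2. split; [|split; [|split; [|split]]].
  - eapply reach_trans with (k1 := 4%nat);
      [|eapply reach_trans with (k2 := (10 * q + 4)%nat); [exact R1| |apply le_n]|lia].
    + step. rewrite (proj2 (Nat.leb_gt _ _)) by nia.
      do 3 step. rewrite !Nat.add_0_r. apply reach_refl.
    + rewrite (Nat.add_comm (10 * q)).
      do 3 step. revert R2.
      replace (2 + (i * q + q) - q)%nat with (2 + (i * q + 0))%nat by lia.
      replace (2 + n * q + (i * q + q) - q)%nat with (2 + n * q + i * q)%nat by lia.
      rewrite !Nat.add_0_r. intros R2.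
      eapply reach_trans; [apply (reach_refl _ _ 0)|exact R2|lia].
  - intros j Hj. rewrite H4, H1 by lia. now look.
  - rewrite H4, H2 by lia. now look.
  - rewrite H4, H1 by lia. now look.
  - intros c Hc. rewrite H5, H3 by lia. rewrite !(H1 7%nat), !(H1 8%nat) by lia.
    rewrite !(H4 10%nat), !(H4 13%nat) by lia. now look. }
  now look.
Qed.

Lemma coord_update i c F p7 : (i < n)%nat -> (c < q)%nat ->
  exists F',
    reach 14 (st 83 (2 + (i * q + q)) (2 + n * q + i * q) p7 c F)%nat
     (st 56 (2 + S i * q) (2 + n * q + S i * q) (base + (14 + c)) c F')%nat /\
    (forall j, (j < 7)%nat -> F' j = F j) /\
    F' 7%nat = F 7%nat * P i c /\
    F' 8%nat = F (14 + c)%nat * F 13%nat - F 7%nat * P i c * F 10%nat /\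
    F' 9%nat = F 9%nat * Q i c /\ F' 10%nat = F 10%nat.
Proof.
  intros Hi Hc. eexists; split.
  - step. replace (2 + (i * q + q) - q)%nat with (2 + i * q)%nat by lia.
    step. rewrite <- Nat.add_assoc. step. rewrite <- (Nat.add_assoc _ _ c).
    step. rewrite <- (Nat.add_assoc base 14 c).
    step. step. rewrite mem_P by easy.
    do 3 step. rewrite mem_Q by easy. do 5 step.
    replace (2 + (i * q + c) - c + q)%nat with (2 + S i * q)%nat by lia.
    replace (2 + n * q + (i * q + c) - c + q)%nat with (2 + n * q + S i * q)%nat by lia.
    apply reach_refl.
  - repeat split; intros; now look.
Qed.

Lemma weight_sum i a h d den :
  rsum (seq 0 q) (P i) = 1 -> den <> 0 ->
  den = a * (rsum (seq 0 q) (excess P Q i) + d) + h ->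
  rsum (seq 0 q) (fun c => weight i a h d den (excess P Q i c) c) = 1.
Proof.
  intros H1 Hd E.
  rewrite (rsum_ext _ _ (fun c => a / den * excess P Q i c + (a * d + h) / den * P i c))
    by (intros; unfold weight; field; easy).
  rewrite rsum_plus, !rsum_scal, H1. rewrite E in Hd |- *. field. easy.
Qed.

(** The machine follows the recursion of [sampler]. [V] bounds below what the program earns from pc
    97 on, and [F0] records the cells below 7, which the coordinates leave unchanged. *)
Lemma coord_loop V F0 f G m i a h e F p7 p9 :
  (forall x, 0 <= G x) -> F0 0%nat = 0 -> (i + m = n)%nat -> marginal_rows q m i P ->
  (forall j, (j < 7)%nat -> F j = F0 j) ->
  F 7%nat = a -> F 8%nat = h -> F 9%nat = e -> F 10%nat = total q P Q m i ->
  0 <= a -> 0 <= h -> 0 < a * total q P Q m i + h ->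
  (forall F p5 p6 p7 p9, (forall j, (j < 7)%nat -> F j = F0 j) ->
    V (F 7%nat) (F 8%nat) (F 9%nat) <= run q (prog q) f G (st 97 p5 p6 p7 p9 F)%nat) ->
  sampler q P Q V m i a h e <=
  run q (prog q) ((19 * q + 24) * m + 1 + f) G
    (st 56 (2 + i * q) (2 + n * q + i * q) p7 p9 F)%nat.
Proof.
  intros HG HF0 Him HP HF Ha Hh He Ht Ha0 Hh0 Hpos HV.
  revert i a h e F p7 p9 Him HP HF Ha Hh He Ht Ha0 Hh0 Hpos.
  induction m as [|m IH]; intros.
  - eapply reach_run with (k := 1%nat) (f := f); [easy| |lia|].
    + step. rewrite (proj2 (Nat.leb_le _ _)) by nia. apply reach_refl.
    + simpl. rewrite <- Ha, <- Hh, <- He. now apply HV.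
  - destruct (coord_weights i F p7 p9) as (F1 & R1 & H1 & H2 & H3 & H4);
      [lia|now rewrite HF by lia|].
    rewrite Ht in H2, H3. simpl in H2. rewrite Ha, Hh in H3.
    assert (E10 : F1 10%nat = total q P Q m (S i)) by (rewrite H2; ring). rewrite E10 in H4.
    apply marginal_rows_S in HP as (HP & HP0 & HP1).
    set (den := a * total q P Q (S m) i + h) in *.
    assert (Hw0 : forall c, (c < q)%nat -> 0 <= weight i a h (total q P Q m (S i)) den
        (excess P Q i c) c).
    { intros c Hc. apply Rmult_le_pos; [|left; now apply Rinv_0_lt_compat].
      assert (HT := total_ge0 q P Q m (S i)). assert (Hx := excess_ge0 P Q i c).
      specialize (HP0 c ltac:(apply in_seq; lia)).
      apply Rplus_le_le_0_compat; apply Rmult_le_pos; try easy.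
      apply Rplus_le_le_0_compat; [apply Rmult_le_pos|]; easy. }
    (* The successor pays for [Sample] and 14 for [coord_update]: with [19 q + 9] this makes
       [19 q + 24] per coordinate. *)
    eapply reach_run with (f := S (14 + ((19 * q + 24) * m + 1 + f)));
      [easy|exact R1|lia|].
    eapply run_sample with
      (w := fun c => weight i a h (total q P Q m (S i)) den (excess P Q i c) c);
      [reflexivity| |easy| |].
    + intros c Hc. cbn [ints Nat.ltb Nat.leb nth Nat.sub].
      now rewrite <- Nat.add_assoc, mem_scratch, H4, H3, Ha, Hh.
    + apply weight_sum; [easy|lra|easy].
    + simpl sampler. apply rsum_le; intros c Hc. apply in_seq in Hc.
      destruct Hc as [_ Hc]. simpl in Hc.
      change (rsum (seq 0 q) (excess P Q i) + total q P Q m (S i))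
        with (total q P Q (S m) i). fold den.
      fold (weight i a h (total q P Q m (S i)) den (excess P Q i c) c).
      (* A value of weight 0 contributes nothing; for the others the next mass is positive. *)
      destruct (Hw0 c Hc) as [Hlt|Heq]; [|rewrite <- Heq; lra].
      apply Rmult_le_compat_l; [lra|].
      destruct (coord_update i c F1 (base + (14 + q)) ltac:(lia) Hc)
        as (F2 & R2 & K1 & K2 & K3 & K4 & K5).
      rewrite updn_9. eapply reach_run; [easy|exact R2|apply le_n|].
      assert (HT := total_ge0 q P Q m (S i)). assert (Hx := excess_ge0 P Q i c).
      specialize (HP0 c ltac:(apply in_seq; lia)).
      (* Weight times normalisation is the mass of the next state. This shows that the recovered [h]
         is correct and that the next mass is positive. *)
      assert (Ew : weight i a h (total q P Q m (S i)) den (excess P Q i c) c * den =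
        a * P i c * total q P Q m (S i) + (h * P i c + a * excess P Q i c))
        by (unfold weight; field; lra).
      apply IH; try easy; try lia.
      * intros j Hj. now rewrite K1, H1, HF by lia.
      * now rewrite K2, H1, Ha by lia.
      * rewrite K3, H4, H3, E10, (H1 7%nat), Ha, Hh by (easy || lia). fold den.
        rewrite Ew. ring.
      * now rewrite K4, H1, He by lia.
      * now rewrite K5.
      * now apply Rmult_le_pos.
      * apply Rplus_le_le_0_compat; now apply Rmult_le_pos.
      * rewrite <- Ew. now apply Rmult_lt_0_compat.
Qed.

(** The loop compares the count with the real target [y], so it draws [T], the ceiling of [y],
    samples; [r] of them remain and [s] has been accumulated. *)
Lemma main_loop y T G r s F p5 p6 p7 p9 :
  (forall x, 0 <= G x) -> is_marginals q n P -> is_marginals q n Q ->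
  0 < total q P Q n 0 -> y <= INR T < y + 1 -> (0 < T)%nat -> (r <= T)%nat ->
  F 0%nat = 0 -> F 1%nat = 1 -> F 2%nat = total q P Q n 0 -> F 4%nat = y ->
  F 5%nat = INR (T - r) -> F 6%nat = s ->
  iter_mean (tuples q n) (proposal q P Q n) (ratio P Q)
    (fun s => G (s * total q P Q n 0 / INR T)) r s <=
  run q (prog q) (((19 * q + 24) * n + 14) * r + 5) G (st 48 p5 p6 p7 p9 F).
Proof.
  intros HG HP HQ Hpos Hy HT. revert s F p5 p6 p7 p9.
  induction r as [|r IH]; intros s F p5 p6 p7 p9 Hr F0 F1 F2 F4 F5 F6.
  - rewrite Nat.sub_0_r in F5.
    eapply reach_run with (k := 4%nat) (f := 1%nat); [easy| |lia|].
    + step. destruct (Rle_dec _ _) as [|Hn]; [|rewrite F4, F5 in Hn; exfalso; lra].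
      do 3 step. apply reach_refl.
    + simpl. rewrite updr_eq, F6, F2, F5, F0. right. f_equal. ring.
  (* At most [T - 1] samples have been drawn and [T - 1 < y], so the exit test fails. *)
  - assert (Hlt : INR (T - S r) < y).
    { rewrite minus_INR, S_INR by easy. pose proof (pos_INR r). lra. }
    set (V := fun v => iter_mean (tuples q n) (proposal q P Q n) (ratio P Q)
      (fun s => G (s * total q P Q n 0 / INR T)) r (s + v)).
    change (rsum (tuples q n) (fun x => proposal q P Q n x * V (ratio P Q x)) <=
      run q (prog q) (((19 * q + 24) * n + 14) * S r + 5) G (st 48 p5 p6 p7 p9 F)).
    rewrite <- sample_ratio_mean by easy. unfold sample_ratio.
    eapply reach_run with (k := 8%nat)
      (f := ((19 * q + 24) * n + 1 + (5 + (((19 * q + 24) * n + 14) * r + 5)))%nat);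
      [easy| |lia|].
    + step. destruct (Rle_dec _ _) as [Hn|_]; [rewrite F4, F5 in Hn; exfalso; lra|].
      do 7 step. apply reach_refl.
    + eapply coord_loop with (i := 0%nat) (F0 := updr F 5 (INR (T - r)));
        try easy; look; try lra.
      * now apply is_marginals_rows.
      * intros j Hj. destruct (Nat.eq_dec j 5) as [->|]; look; [|easy].
        rewrite F5, F1. rewrite !minus_INR, S_INR by lia. ring.
      * intros F' q5 q6 q7 q9 HF'.
        assert (E0 : F' 0%nat = 0) by (rewrite HF' by lia; now look).
        assert (E1 : F' 1%nat = 1) by (rewrite HF' by lia; now look).
        assert (E2 : F' 2%nat = total q P Q n 0) by (rewrite HF' by lia; now look).
        assert (E4 : F' 4%nat = y) by (rewrite HF' by lia; now look).
        assert (E5 : F' 5%nat = INR (T - r)) by (rewrite HF' by lia; now look).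
        assert (E6 : F' 6%nat = s) by (rewrite HF' by lia; now look).
        unfold V. destruct (Rle_dec (F' 7%nat - F' 9%nat) 0) as [Hle|Hle].
        -- eapply reach_run with (k := 2%nat); [easy| |apply (Nat.add_le_mono_r 2 5); lia|].
           ++ step. step. rewrite E0. destruct (Rle_dec _ _); [|easy]. apply reach_refl.
           ++ apply IH; look; try easy; [lia|].
              rewrite E6, pos_0 by easy. unfold Rdiv. ring.
        -- eapply reach_run with (k := 5%nat); [easy| |apply le_n|].
           ++ step. step. rewrite E0. destruct (Rle_dec _ _); [easy|].
              do 3 step. apply reach_refl.
           ++ apply IH; look; try easy; [lia|].
              rewrite E6, pos_id by lra. easy.
Qed.

(** * Computation of the total mass and of the number of samples *)

Lemma total_cell i c F p7 p9 : (i < n)%nat -> (c < q)%nat -> F 0%nat = 0 ->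
  exists F',
    reach 7 (st 29 (2 + (i * q + c)) (2 + n * q + (i * q + c)) p7 p9 F)%nat
     (st 29 (2 + (i * q + S c)) (2 + n * q + (i * q + S c)) p7 p9 F')%nat /\
    (forall j, j <> 2%nat -> j <> 11%nat -> F' j = F j) /\
    F' 2%nat = F 2%nat + excess P Q i c.
Proof.
  intros Hi Hc H0. unfold excess. assert (Hic := cell_lt i c Hi Hc).
  replace (2 + (i * q + S c))%nat with (2 + (i * q + c) + 1)%nat by lia.
  replace (2 + n * q + (i * q + S c))%nat with (2 + n * q + (i * q + c) + 1)%nat by lia.
  destruct (Rle_dec (P i c - Q i c) 0) as [Hs|Hs]; eexists; split.
  - step. rewrite (proj2 (Nat.leb_gt _ _)) by lia.
    step. rewrite mem_P, mem_Q by easy.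
    step. rewrite H0. destruct (Rle_dec _ _); [|easy].
    do 3 step. apply reach_refl.
  - rewrite pos_0 by easy. split; intros; look; [easy|ring].
  - step. rewrite (proj2 (Nat.leb_gt _ _)) by lia.
    step. rewrite mem_P, mem_Q by easy.
    step. rewrite H0. destruct (Rle_dec _ _); [easy|].
    do 4 step. apply reach_refl.
  - rewrite pos_id by lra. split; intros; now look.
Qed.

Lemma total_row i k c F p7 p9 : (i < n)%nat -> (c + k = q)%nat -> F 0%nat = 0 ->
  exists F',
    reach (7 * k) (st 29 (2 + (i * q + c)) (2 + n * q + (i * q + c)) p7 p9 F)%nat
     (st 29 (2 + (i * q + q)) (2 + n * q + (i * q + q)) p7 p9 F')%nat /\
    (forall j, j <> 2%nat -> j <> 11%nat -> F' j = F j) /\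
    F' 2%nat = F 2%nat + rsum (seq c k) (excess P Q i).
Proof.
  intros Hi. revert c F; induction k as [|k IH]; intros c F Hck H0.
  - exists F. replace c with q by lia. split; [apply reach_refl|].
    split; [easy|]. simpl; ring.
  - destruct (total_cell i c F p7 p9) as (F1 & R1 & H1 & H2); [lia..|easy|].
    destruct (IH (S c) F1) as (F2 & R2 & H4 & H5); [lia|rewrite H1; easy|].
    exists F2. split; [eapply reach_trans; [exact R1|exact R2|lia]|]. split.
    + intros j Hj Hj'. now rewrite H4, H1.
    + rewrite H5, H2. simpl. ring.
Qed.

Lemma total_loop m i F p7 p9 : (i + m = n)%nat -> F 0%nat = 0 ->
  exists F' p5 p6,
    reach (7 * q * m + 1) (st 29 (2 + i * q) (2 + n * q + i * q) p7 p9 F)%nat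
     (st 36 p5 p6 p7 p9 F') /\
    (forall j, j <> 2%nat -> j <> 11%nat -> F' j = F j) /\
    F' 2%nat = F 2%nat + total q P Q m i.
Proof.
  revert i F; induction m as [|m IH]; intros i F Him H0.
  - eexists F, _, _. split; [|split; [easy|simpl; ring]].
    rewrite Nat.mul_0_r.
    step. rewrite (proj2 (Nat.leb_le _ _)) by nia. apply reach_refl.
  - destruct (total_row i q 0 F p7 p9) as (F1 & R1 & H1 & H2); [lia..|easy|].
    destruct (IH (S i) F1) as (F2 & p5 & p6 & R2 & H4 & H5); [lia|rewrite H1; easy|].
    exists F2, p5, p6. split; [|split].
    + rewrite !Nat.add_0_r in R1. eapply reach_trans; [exact R1| |].
      * replace (i * q + q)%nat with (S i * q)%nat by lia. exact R2.
      * lia.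
    + intros j Hj Hj'. now rewrite H4, H1.
    + rewrite H5, H2. simpl. ring.
Qed.

(** Doubling replaces a logarithm: each doubling of cell 3 adds one batch to the target. [k] only
    guarantees termination; the number [j] of doublings is minimal, which is recorded as
    [r * 2 ^ j < 2] unless [j = 0]. *)
Lemma doubling_loop k r F p5 p6 p7 p9 :
  F 1%nat = 1 -> F 3%nat = r -> 1 <= r * 2 ^ k ->
  exists j F',
    reach (4 * j + 1) (st 44 p5 p6 p7 p9 F) (st 48 p5 p6 p7 p9 F') /\
    (forall i, i <> 3%nat -> i <> 4%nat -> F' i = F i) /\
    F' 4%nat = F 4%nat + INR j * F 11%nat /\
    1 <= r * 2 ^ j /\ (j = O \/ r * 2 ^ j < 2).
Proof.
  revert r F; induction k as [|k IH]; intros r F H1 H3 Hk.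
  all: destruct (Rle_dec 1 r) as [Hr|Hr];
    [exists O, F; split; [|repeat split; auto; simpl; try ring; lra];
     step; rewrite H1, H3; destruct (Rle_dec _ _); [apply reach_refl|easy]|].
  { simpl in Hk. lra. }
  set (F1 := updr (updr F 3 (r + r)) 4 (F 4%nat + F 11%nat)).
  destruct (IH (2 * r) F1) as (j & F2 & R2 & K1 & K2 & K3 & K4).
  - unfold F1; now look.
  - unfold F1; look. ring.
  - simpl in Hk. lra.
  - exists (S j), F2. split; [|split; [|split; [|split]]].
    + eapply reach_trans with (k1 := 4%nat); [|exact R2|lia].
      step. rewrite H1, H3. destruct (Rle_dec _ _); [easy|].
      do 3 step. rewrite H3. apply reach_refl.
    + intros i Hi Hi'. rewrite K1 by easy. unfold F1; now look.
    + rewrite K2, S_INR. unfold F1; look. ring.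
    + simpl. lra.
    + right. destruct K4 as [->|K4]; simpl; lra.
Qed.

(** * Set-up of the registers *)

Definition setup_regs (x3 x9 : nat) (k : nat) : nat :=
  nth k [n; 0; 1; x3; q; 0; 0; 0; 0; x9]%nat O.

(** The product [n q] is formed by [q] additions of [n], so the set-up costs O(q) steps whatever [n]
    is, as the case of large [eps] demands. *)
Lemma setup : exists F p9,
  reach (4 * q + 24) (init q n P Q eps delta) (st 26 0 0 0 p9 F) /\
  F 1%nat = 1 /\ (forall j, j <> 1%nat -> F j = 0).
Proof.
  set (M := rreg (init q n P Q eps delta)).
  (* From [base] on, the initial memory holds the default value 0. *)
  assert (HM : M = mem (fun _ => 0)).
  { apply functional_extensionality; intros k. unfold mem.
    destruct (Nat.ltb_spec k base); [easy|]. unfold M, init, base in *; cbn [rreg].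
    rewrite !(proj2 (Nat.eqb_neq _ _)), !(proj2 (Nat.ltb_ge _ _)) by lia. easy. }
  assert (Hl : forall k c, (c + k = q)%nat ->
    reach (4 * k + 1) (mkState 2 (setup_regs (c * n) c) M)
      (mkState 6 (setup_regs (q * n) q) M)).
  { induction k as [|k IH]; intros c Hck.
    - replace c with q by lia.
      eapply reach_step; [reflexivity|exact I|]. cbn. rewrite Nat.leb_refl. apply reach_refl.
    - eapply reach_trans with (k1 := 4%nat); [|apply (IH (S c)); lia|lia].
      eapply reach_step; [reflexivity|exact I|]. cbn [exec_det pc ireg rreg setup_regs nth].
      rewrite (proj2 (Nat.leb_gt _ _)) by lia.
      do 3 (eapply reach_step; [reflexivity|exact I|];
        cbn [exec_det jump pc ireg rreg updn Nat.eqb setup_regs nth Nat.leb]).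
      replace (updn _ _ _) with (setup_regs (S c * n) (S c)); [apply reach_refl|].
      apply functional_extensionality; intros j.
      do 10 (destruct j; [cbn; lia|]). reflexivity. }
  eexists _, _. split.
  - eapply reach_trans with (k1 := 2%nat) (k2 := (22 + (4 * q))%nat); [| |lia].
    { do 2 (eapply reach_step; [reflexivity|exact I|]).
      apply reach_refl. }
    eapply reach_trans with (k1 := (4 * q + 1)%nat) (k2 := 21%nat); [| |lia].
    { cbn [exec_det pc ireg rreg]. fold M.
      replace (updn _ _ _) with (setup_regs (0 * n) 0); [apply Hl; lia|].
      apply functional_extensionality; intros j.
      do 10 (destruct j; [reflexivity|]). now destruct j. }
    do 19 (eapply reach_step; [reflexivity|exact I|];
        cbn [exec_det jump pc ireg rreg updn Nat.eqb setup_regs nth Nat.leb]).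
    replace (updn _ _ _) with (ints 0 0 0 (2 + q * n)).
    + rewrite HM. step. apply reach_refl.
    + apply functional_extensionality; intros j. unfold ints, base.
      do 25 (destruct j; [cbn -[Nat.mul]; lia|]). now destruct j.
  - split; [now look|]. intros j Hj. now look.
Qed.

(** * Complete runs of the program *)

Lemma halt_0 N G F p5 p6 p7 p9 : (2 <= N)%nat -> (forall x, 0 <= G x) ->
  G 0 <= run q (prog q) N G (st 106 p5 p6 p7 p9 F).
Proof.
  intros HN HG. eapply reach_run with (k := 1%nat) (f := 1%nat); [easy| |lia|].
  - step. apply reach_refl.
  - simpl. rewrite updr_eq. right. f_equal. ring.
Qed.

Lemma run_eps_ge1 G : 1 <= eps -> (forall x, 0 <= G x) ->
  G 0 <= run q (prog q) (4 * q + 27) G (init q n P Q eps delta).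
Proof.
  intros He HG. destruct setup as (F & p9 & R & F1 & _).
  eapply reach_run with (f := 3%nat); [easy|exact R|lia|].
  eapply reach_run with (k := 1%nat) (f := 2%nat); [easy| |lia|now apply halt_0].
  step. rewrite F1. destruct (Rle_dec _ _); [|easy]. apply reach_refl.
Qed.

Lemma total_computed : eps < 1 -> exists F p5 p6 p7 p9,
  reach (4 * q + 7 * q * n + 28) (init q n P Q eps delta) (st 36 p5 p6 p7 p9 F) /\
  F 0%nat = 0 /\ F 1%nat = 1 /\ F 2%nat = total q P Q n 0 /\
  F 5%nat = 0 /\ F 6%nat = 0.
Proof.
  intros He. destruct setup as (F & p9 & R & F1 & FN).
  destruct (total_loop n 0 F 0 p9) as (F' & p5 & p6 & R' & K1 & K2); [lia|now apply FN|].
  exists F', p5, p6, 0%nat, p9. split.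
  - eapply reach_trans with (k2 := (3 + (7 * q * n + 1))%nat); [exact R| |lia].
    step. rewrite F1. destruct (Rle_dec _ _); [exfalso; lra|].
    do 2 step. revert R'. rewrite !Nat.add_0_r. now intros.
  - rewrite K2, (K1 0%nat), (K1 1%nat), (K1 5%nat), (K1 6%nat), F1, !FN by easy.
    repeat split. ring.
Qed.

Lemma run_total_0 G : eps < 1 -> total q P Q n 0 = 0 -> (forall x, 0 <= G x) ->
  G 0 <= run q (prog q) (4 * q + 7 * q * n + 31) G (init q n P Q eps delta).
Proof.
  intros He H0 HG. destruct (total_computed He) as (F & p5 & p6 & p7 & p9 & R & F0 & F1 & F2 & _).
  eapply reach_run with (f := 3%nat); [easy|exact R|lia|].
  eapply reach_run with (k := 1%nat) (f := 2%nat); [easy| |lia|now apply halt_0].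
  step. rewrite F2, F0. destruct (Rle_dec _ _); [|exfalso; lra]. apply reach_refl.
Qed.

Lemma nat_ceil y : 0 < y -> exists T, y <= INR T < y + 1 /\ (0 < T)%nat.
Proof.
  (* [up] is the least integer strictly above its argument, so [1 - up (- y)] is the ceiling of
     [y]. *)
  intros Hy. destruct (archimed (- y)) as [H1 H2].
  assert (Hz : (0 < 1 - up (- y))%Z) by (apply lt_IZR; rewrite minus_IZR; lra).
  exists (Z.to_nat (1 - up (- y))).
  rewrite INR_IZR_INZ, Z2Nat.id, minus_IZR by lia. split; [lra|lia].
Qed.

(** [k] is the number of doublings and [T] the number of samples in the actual run. The lower bound
    on [delta * 2 ^ k] controls the failure probability, the upper bound the running time. *)
Lemma run_sampling :
  is_marginals q n P -> is_marginals q n Q -> 0 < eps < 1 -> 0 < delta < 1 ->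
  0 < total q P Q n 0 ->
  exists k T : nat,
    1 <= delta * 2 ^ k /\ (k = O \/ delta * 2 ^ k < 2) /\ (0 < T)%nat /\
    INR (k + 1) * (8 * INR n / eps ^ 2) <= INR T < INR (k + 1) * (8 * INR n / eps ^ 2) + 1 /\
    forall G, (forall x, 0 <= G x) ->
    iter_mean (tuples q n) (proposal q P Q n) (ratio P Q)
      (fun s => G (s * total q P Q n 0 / INR T)) T 0 <=
    run q (prog q) (4 * q + 7 * q * n + 4 * k + ((19 * q + 24) * n + 14) * T + 42) G
      (init q n P Q eps delta).
Proof.
  intros HP HQ He Hd Hpos.
  destruct (total_computed ltac:(lra)) as (F & p5 & p6 & p7 & p9 & R & F0 & F1 & F2 & F5 & F6).
  set (y0 := 8 * INR n / eps / eps).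
  assert (Hn : (0 < n)%nat) by (destruct n; simpl in Hpos; [lra|lia]).
  assert (Hy0 : 0 < y0).
  { apply lt_0_INR in Hn. apply Rdiv_lt_0_compat; [apply Rdiv_lt_0_compat|]; lra. }
  (* [K] only witnesses that the doubling ends; the machine may stop earlier. *)
  destruct (Pow_x_infinity 2 ltac:(rewrite Rabs_pos_eq; lra) (/ delta)) as [K HK].
  specialize (HK K (le_n K)). rewrite Rabs_pos_eq in HK by (apply pow_le; lra).
  assert (HK' : 1 <= delta * 2 ^ K).
  { apply Rge_le, (Rmult_le_compat_l delta) in HK; [|lra]. rewrite Rinv_r in HK; lra. }
  assert (HA : exists FA, reach 8 (st 36 p5 p6 p7 p9 F) (st 44 p5 p6 p7 p9 FA) /\
    FA 3%nat = delta /\ FA 4%nat = y0 /\ FA 11%nat = y0 /\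
    (forall j, In j [0; 1; 2; 5; 6]%nat -> FA j = F j)).
  { eexists; split.
    - step. rewrite F2, F0. destruct (Rle_dec _ _); [exfalso; lra|].
      do 7 step. apply reach_refl.
    - look. rewrite F0. replace (INR 8) with 8 by (simpl; ring).
      fold y0. repeat split; try ring. simpl. intros j Hj. now look. }
  destruct HA as (FA & RA & A3 & A4 & A11 & A).
  destruct (doubling_loop K delta FA p5 p6 p7 p9) as (k & F' & R' & K1 & K2 & K3 & K4);
    [rewrite A; simpl; auto|easy..|].
  rewrite A4, A11 in K2.
  assert (EF : INR (k + 1) * (8 * INR n / eps ^ 2) = F' 4%nat).
  { rewrite K2, plus_INR. unfold y0. simpl. field. lra. }
  destruct (nat_ceil (F' 4%nat)) as (T & HT & HT0).
  { rewrite K2. pose proof (pos_INR k). nra. }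
  exists k, T. rewrite EF. repeat split; try easy. intros G HG.
  eapply reach_run with (f := (8 + (4 * k + 1) + (((19 * q + 24) * n + 14) * T + 5))%nat);
    [easy|exact R|lia|].
  eapply reach_run with (k := 8%nat)
    (f := (4 * k + 1 + (((19 * q + 24) * n + 14) * T + 5))%nat); [easy|exact RA|lia|].
  eapply reach_run; [easy|exact R'|apply le_n|].
  apply main_loop with (y := F' 4%nat); try easy;
    rewrite ?Nat.sub_diag, K1, A by (simpl; auto 10); easy.
Qed.
End Correctness.

(** * Failure probability and running time *)

Lemma sampling_fails_le_delta n d D eps delta k T :
  0 < D -> D <= INR n * d -> 0 < eps -> 0 < delta -> 1 <= delta * 2 ^ k ->
  INR (k + 1) * (8 * INR n / eps ^ 2) <= INR T ->
  2 * exp (- (INR T * (d / D) * eps ^ 2 / 8)) <= delta.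
Proof.
  intros HD Hd He Hdel Hk HT.
  assert (Hn : 0 < INR n) by (destruct (pos_INR n) as [|E]; [easy|rewrite <- E in Hd; lra]).
  assert (He2 : 0 < eps ^ 2) by now apply pow_lt.
  (* The mean of the ratio is at least 1/n, so [T] samples make the Chernoff exponent at least
     [k + 1]. *)
  assert (Hr : / INR n <= d / D).
  { apply Rmult_le_reg_l with (INR n * D); [now apply Rmult_lt_0_compat|].
    replace (INR n * D * / INR n) with D by (field; lra).
    replace (INR n * D * (d / D)) with (INR n * d) by (field; lra). easy. }
  assert (HE : INR (k + 1) <= INR T * (d / D) * eps ^ 2 / 8).
  { apply Rle_trans with (INR (k + 1) * (8 * INR n / eps ^ 2) * / INR n * eps ^ 2 / 8).
    - right. field. lra.
    - apply Rmult_le_compat_r; [lra|]. apply Rmult_le_compat_r; [lra|].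
      apply Rmult_le_compat; try easy; [|left; now apply Rinv_0_lt_compat].
      apply Rmult_le_pos; [apply pos_INR|].
      apply Rmult_le_pos; [lra|left; now apply Rinv_0_lt_compat]. }
  (* As e >= 2, the failure probability is at most 2 / 2^(k+1) = 2^(-k) <= [delta]. *)
  assert (H2 : 2 ^ (k + 1) <= exp (INR T * (d / D) * eps ^ 2 / 8)).
  { apply Rle_trans with (exp 1 ^ (k + 1)).
    - apply pow_incr. pose proof (exp_ineq1_le 1). lra.
    - rewrite exp_pow, Rmult_1_r. destruct HE as [HE|<-]; [left; now apply exp_increasing|lra]. }
  rewrite exp_Ropp. revert H2. generalize (exp (INR T * (d / D) * eps ^ 2 / 8)).
  intros x Hx. rewrite pow_add, pow_1 in Hx.
  assert (H2k : 0 < 2 ^ k) by (apply pow_lt; lra).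
  apply Rmult_le_reg_r with x; [lra|].
  rewrite Rmult_assoc, Rinv_l by lra. nra.
Qed.

Lemma ln_inv_ge0 delta : 0 < delta < 1 -> 0 <= ln (/ delta).
Proof.
  intros Hd. rewrite <- ln_1. left. apply ln_increasing; [lra|].
  rewrite <- Rinv_1. apply Rinv_lt_contravar; lra.
Qed.

(** For the runs whose length is independent of [n]: the summands 1 in both factors absorb them. *)
Lemma cost_bound_const q n eps delta :
  0 < eps -> 0 < delta < 1 ->
  INR (4 * q + 42) <=
  (400 * INR q + 1000) * (1 + INR n ^ 3 / eps ^ 2) * (1 + ln (/ delta)).
Proof.
  intros He Hd. assert (HL := ln_inv_ge0 delta Hd). assert (Hq := pos_INR q).
  assert (HX : 0 <= INR n ^ 3 / eps ^ 2).
  { apply Rmult_le_pos; [apply pow_le, pos_INR|].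
    left. apply Rinv_0_lt_compat. now apply pow_lt. }
  revert HX HL. generalize (INR n ^ 3 / eps ^ 2) (ln (/ delta)). intros X L HX HL.
  assert (1 <= (1 + X) * (1 + L)) by nra.
  rewrite plus_INR, mult_INR.
  replace (INR 4) with 4 by (simpl; ring). replace (INR 42) with 42 by (simpl; ring).
  rewrite Rmult_assoc. nra.
Qed.

(** The dominant term is [n T], of order n^2/eps^2 log(1/delta); [n >= 1] and [eps < 1] bring it and
    the lower-order terms under the claimed bound. *)
Lemma cost_bound (q n k T : nat) eps delta :
  (1 <= q)%nat -> (1 <= n)%nat -> 0 < eps < 1 -> 0 < delta < 1 ->
  (k = O \/ delta * 2 ^ k < 2) ->
  INR T < INR (k + 1) * (8 * INR n / eps ^ 2) + 1 ->
  INR (4 * q + 7 * q * n + 4 * k + ((19 * q + 24) * n + 14) * T + 42) <=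
  (400 * INR q + 1000) * (1 + INR n ^ 3 / eps ^ 2) * (1 + ln (/ delta)).
Proof.
  intros Hq Hn He Hd Hk HT.
  set (L := ln (/ delta)). set (X := INR n ^ 3 / eps ^ 2).
  apply le_INR in Hq, Hn. simpl in Hq, Hn.
  assert (HL : 0 <= L) by now apply ln_inv_ge0.
  (* [delta * 2 ^ k < 2] gives (k - 1) ln 2 < [L], and ln 2 > 1/2. *)
  assert (HkL : INR k <= 1 + 2 * L).
  { destruct Hk as [->|Hk]; [simpl; lra|].
    assert (H2k : 0 < 2 ^ k) by (apply pow_lt; lra).
    apply ln_increasing in Hk; [|now apply Rmult_lt_0_compat; lra].
    rewrite ln_mult, ln_pow in Hk by lra.
    assert (EL : L = - ln delta) by (apply ln_Rinv; lra).
    destruct (Rle_dec (INR k) 1) as [Hk1|Hk1]; [lra|].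
    assert (0 <= (INR k - 1) * (ln 2 - / 2))
      by (apply Rmult_le_pos; [|pose proof ln_lt_2]; lra).
    lra. }
  assert (He2 : 0 < eps ^ 2) by now apply pow_lt.
  assert (Hi : 1 <= / eps ^ 2).
  { rewrite <- Rinv_1. apply Rinv_le_contravar; [easy|]. simpl. nra. }
  assert (Hv : INR n <= INR n / eps ^ 2).
  { rewrite <- (Rmult_1_r (INR n)) at 1. apply Rmult_le_compat_l; lra. }
  assert (H1 : INR n <= INR n * (INR n / eps ^ 2)) by nra.
  assert (EX : X = INR n * (INR n * (INR n / eps ^ 2))) by (unfold X; field; lra).
  assert (H2 : INR n * (INR n / eps ^ 2) <= X) by (rewrite EX; nra).
  assert (HX : 1 <= X) by lra.
  set (u := (1 + X) * (1 + L)).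
  (* With [k + 1 <= 2 + 2 L], the batches give at most 16 [u]; rounding [T] up adds [n], at most one
     more [u]. *)
  assert (HnT : INR n * INR T <= 17 * u).
  { apply Rle_trans with (INR n * (INR (k + 1) * (8 * INR n / eps ^ 2) + 1)).
    { apply Rmult_le_compat_l; lra. }
    replace (INR n * (INR (k + 1) * (8 * INR n / eps ^ 2) + 1))
      with (8 * (INR (k + 1) * (INR n * (INR n / eps ^ 2))) + INR n) by (field; lra).
    assert (INR (k + 1) * (INR n * (INR n / eps ^ 2)) <= (2 + 2 * L) * X).
    { apply Rmult_le_compat; [apply pos_INR| |rewrite plus_INR; simpl; lra|easy].
      apply Rmult_le_pos; [lra|]. apply Rmult_le_pos; lra. }
    unfold u. nra. }
  assert (HT0 := pos_INR T). assert (Hk0 := pos_INR k).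
  assert (Hu : 1 <= u /\ X <= u /\ L <= u) by (unfold u; nra).
  destruct Hu as (Hu1 & Hu2 & Hu3).
  repeat rewrite ?plus_INR, ?mult_INR.
  replace (INR 4) with 4 by (simpl; ring). replace (INR 7) with 7 by (simpl; ring).
  replace (INR 14) with 14 by (simpl; ring). replace (INR 19) with 19 by (simpl; ring).
  replace (INR 24) with 24 by (simpl; ring). replace (INR 42) with 42 by (simpl; ring).
  replace ((400 * INR q + 1000) * (1 + X) * (1 + L)) with ((400 * INR q + 1000) * u)
    by (unfold u; ring).
  assert (A1 : INR q * INR n <= INR q * u) by (apply Rmult_le_compat_l; lra).
  assert (A2 : INR q * (INR n * INR T) <= INR q * (17 * u)) by (apply Rmult_le_compat_l; lra).
  assert (A3 : INR T <= INR n * INR T) by nra.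
  assert (A4 : INR q <= INR q * u) by nra.
  (* The coefficients of [u] are 4 + 7 + 19·17 = 334 for [q], and 12 + (24 + 14)·17 + 42 = 700 for
     the constant. *)
  lra.
Qed.

(** * Approximation guarantee and running time of the algorithm *)

Theorem theorem1 (q : nat) (hq : (1 <= q)%nat) :
  exists (prog : list instr) (C : R), 0 < C /\
  forall (n : nat) (P Q : nat -> nat -> R) (eps delta : R),
    is_marginals q n P -> is_marginals q n Q ->
    0 < eps -> 0 < delta < 1 ->
    exists N : nat,
      INR N <= C * (1 + INR n ^ 3 / eps ^ 2) * (1 + ln (/ delta)) /\
      run q prog N (fun _ => 1) (init q n P Q eps delta) = 1 /\
      run q prog N (ind_interval ((1 - eps) * dTV q n P Q) ((1 + eps) * dTV q n P Q))
          (init q n P Q eps delta) >= 1 - delta.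
Proof.
  exists (prog q), (400 * INR q + 1000). assert (Hq := pos_INR q). split; [lra|].
  intros n P Q eps delta HP HQ He Hd.
  set (G := ind_interval _ _).
  assert (HG : forall x, 0 <= G x).
  { intros x. unfold G, ind_interval. destruct Rle_dec; [destruct Rle_dec|]; lra. }
  assert (H1 : forall x : R, 0 <= (fun _ : R => 1) x) by (intros; lra).
  assert (Hle := run_le_1 q (prog q)).
  assert (HP' := proj1 (is_marginals_rows _ _ _) HP).
  assert (HQ' := proj1 (is_marginals_rows _ _ _) HQ).
  assert (Ed := dTV_pos_diff q P Q n HP HQ).
  assert (Hd0 : 0 <= dTV q n P Q).
  { rewrite Ed. apply rsum_ge0; intros; apply pos_ge0. }
  destruct (Rle_dec 1 eps) as [He1|He1].
  - exists (4 * q + 27)%nat. split; [|split].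
    + eapply Rle_trans; [|apply cost_bound_const; easy]. apply le_INR; lia.
    (* Halting almost surely is the same lower bound, for the constant payoff 1. *)
    + apply Rle_antisym; [apply Hle|now apply run_eps_ge1 with (G := fun _ => 1)].
    + apply Rle_ge. eapply Rle_trans; [|now apply run_eps_ge1].
      (* The answer 0 is accepted because [1 - eps <= 0] and the distance is non-negative. *)
      unfold G, ind_interval. destruct Rle_dec as [_|H]; [|exfalso; apply H; nra].
      destruct Rle_dec as [_|H]; [lra|exfalso; apply H; nra].
  - apply Rnot_le_lt in He1.
    destruct (total_ge0 q P Q n 0) as [Hpos|H0].
    + destruct (run_sampling q n P Q eps delta) as (k & T & K1 & K2 & K3 & [K4 K5] & HR);
        try easy.
      assert (Hn : (1 <= n)%nat) by (destruct n; simpl in Hpos; [lra|lia]).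
      eexists. split; [|split].
      * apply (cost_bound q n k T); try easy; lra.
      * apply Rle_antisym; [apply Hle|].
        eapply Rle_trans; [|now apply HR with (G := fun _ => 1)].
        right. symmetry. now apply iter_mean_1, proposal_sum.
      * apply Rle_ge. eapply Rle_trans; [|now apply HR].
        eapply Rle_trans; [|apply sampler_chernoff with (eps := eps); auto].
        -- assert (2 * exp (- (INR T * (dTV q n P Q / total q P Q n 0) * eps ^ 2 / 8)) <= delta);
             [|lra].
           apply sampling_fails_le_delta with n k; try easy.
           rewrite Ed. now apply total_le_pos_diff.
        (* Scaling by [total / T] carries the Chernoff window for the sum of ratios to the window
           required of the output. *)
        -- intros s [Hs1 Hs2]. unfold G, ind_interval.
           assert (HT : 0 < INR T) by now apply lt_0_INR.
           assert (Hc : 0 <= total q P Q n 0 / INR T)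
             by (left; now apply Rdiv_lt_0_compat).
           apply (Rmult_le_compat_r _ _ _ Hc) in Hs1, Hs2.
           destruct Rle_dec as [_|H]; [destruct Rle_dec as [_|H]; [lra|]|];
             exfalso; apply H.
           ++ eapply Rle_trans; [|eapply Rle_trans; [exact Hs2|]]; right; field; lra.
           ++ eapply Rle_trans; [|eapply Rle_trans; [exact Hs1|]]; right; field; lra.
    + assert (Hz : dTV q n P Q = 0).
      { apply Rle_antisym; [|easy]. rewrite Ed, H0. now apply pos_diff_le_total. }
      exists (4 * q + 7 * q * n + 31)%nat. split; [|split].
      (* [cost_bound] assumes [n >= 1]; for [n = 0] the run has constant length. *)
      * destruct n as [|n].
        -- eapply Rle_trans; [|apply cost_bound_const; easy]. apply le_INR; lia.
        -- eapply Rle_trans; [|apply (cost_bound q (S n) 0 0); try easy; auto; try lia].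
           ++ apply le_INR; lia.
           ++ assert (0 <= INR (S n) / eps ^ 2).
              { apply Rmult_le_pos; [apply pos_INR|]. left. apply Rinv_0_lt_compat.
                now apply pow_lt. }
              unfold Rdiv in *. simpl INR at 1 2. lra.
      * apply Rle_antisym; [apply Hle|now apply run_total_0 with (G := fun _ => 1)].
      * apply Rle_ge. eapply Rle_trans; [|now apply run_total_0].
        unfold G, ind_interval. rewrite Hz, !Rmult_0_r.
        destruct (Rle_dec 0 0); lra.
Qed.
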